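(* Let $X$ be a connected locally finite $T_0$-space and let $\{X_p:p\in\mathbb{Z}\}$ be a filtration of $X$ which is induced by antichains. For each $p\in\mathbb{N}$ let $D_p=X_p-X_{p-1}$. Suppose that for all $n\in\mathbb{N}$ there exists $m\in\mathbb{N}$ such that $\tilde H_n(\hat C^{X_p}_x)=0$ for all $p\ge m$ and all $x\in D_p$. Let $G=\pi_1(X)$, let $c:X\to G$ be an admissible and connected $G$-coloring of $X$ corresponding to the universal cover and let $\widetilde X$ be the universal cover of $X$. Then there is a spectral sequence $\{(E^r_{p,q})_{p,q\in\mathbb{Z}},(d^r_{p,q})_{p,q\in\mathbb{Z}}\}_{r\in\mathbb{N}}$ that converges to $H_*(\widetilde X)$ such that: \begin{itemize} \item $E^1_{p,q}=0$ for every $p\le -1$; \item $E^1_{0,q}=H_q(X_0\times G)$, where $X_0\times G$ is given the subspace topology with respect to $E(c)$; \item $E^1_{p,q}=\bigoplus_{x\in D_p}\bigoplus_{g\in G}\tilde H_{p+q-1}(\hat C_x^{X_p})$ for $p\ge1$; \item the morphisms $d^1_{p,q}:E^1_{p,q}\to E^1_{p-1,q}$ are as follows: \begin{itemize} \item if $p\le 0$ and $q\in\mathbb{Z}$, then $d^1_{p,q}$ is trivial; \item if $p=1$ and $q\in\mathbb{N}_0$, then $d^1_{1,q}:\bigoplus_{x\in D_1}\bigoplus_{g\in G}\tilde H_q(\hat C_x^{X_1})\to H_q(X_0\times G)$ is induced by the inclusion maps $\hat C_x^{X_1}\times G\to X_0\times G$, $x\in D_1$; \item if $p\ge1$ and $q\le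 -p$, then $d^1_{p,q}$ is trivial; \item if $p\ge2$ and $q\ge 1-p$, then $d^1_{p,q}$ is the group homomorphism $\bigoplus_{x\in D_p}\bigoplus_{g\in G}\tilde H_{p+q-1}(\hat C_x^{X_p})\to\bigoplus_{y\in D_{p-1}}\bigoplus_{g\in G}\tilde H_{p+q-2}(\hat C_y^{X_{p-1}})$ given by $$d^1_{p,q}\left(\mathrm{inc}_{x,g}\left(\left[\sum_{i=1}^{l}a_is_i\right]\right)\right)=\sum_{y\in D_{p-1}\cap C_x}\mathrm{inc}'_{y,\,g\cdot c(x\le y)}\left(\left[\sum_{i\,:\,y\in s_i}a_i\,\mathrm{sgn}_{s_i}(y)\,(s_i-\{y\})\right]\right)$$ for all $x\in D_p$ and $g\in G$, where $l\in\mathbb{N}$ and for every $i\in\{1,\dots,l\}$, $a_i\in\mathbb{Z}$ and $s_i$ is a $(p+q-1)$-chain of $\hat C_x^{X_p}$ (the sum $\sum_ia_is_i$ being a cycle). Here $\mathrm{inc}_{x,g}$ and $\mathrm{inc}'_{y,h}$ denote the canonical inclusions of $\tilde H_{p+q-1}(\hat C_x^{X_p})$ and $\tilde H_{p+q-2}(\hat C_y^{X_{p-1}})$ as the summands indexed by $(x,g)$ and $(y,h)$ respectively, and if $a\le b$ then $c(b\le a)$ denotes $c(a\le b)^{-1}$. \end{itemize} \end{itemize}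
   Context: $\mathbb{N}=\{1,2,\dots\}$, $\mathbb{N}_0=\mathbb{N}\cup\{0\}$. Alexandroff $T_0$-spaces are identified with posets: the open sets are the down-sets. A locally finite $T_0$-space corresponds to a poset in which every $U_x$ is finite. For a poset $Y$ and $x\in Y$: $U_x^Y=\{a\in Y:a\le x\}$, $F_x^Y=\{a\in Y:a\ge x\}$, $C_x^Y=U_x^Y\cup F_x^Y$, $\hat C_x^Y=C_x^Y-\{x\}$; without superscript, $Y=X$. An $n$-chain is a chain of cardinality $n+1$; the empty chain is a $(-1)$-chain; $[v_0,\dots,v_n]$ denotes the chain $v_0<\dots<v_n$. Homology $H_*(Y)$ is identified with the homology of the complex of free abelian groups on the $n$-chains of $Y$ with $d[v_0,\dots,v_n]=\sum_i(-1)^i[v_0,\dots,\hat{v_i},\dots,v_n]$ (simplicial chain complex of the order complex); reduced homology is computed with the empty chain generating degree $-1$, so $\tilde H_{-1}(\varnothing)=\mathbb{Z}$. For $y=y_k$ in $s=[y_0,\dots,y_n]$, $\mathrm{sgn}_s(y)=(-1)^k$. A filtration $\{X_p:p\in\mathbb{Z}\}$ of $X$ is an increasing family of subspaces with union $X$. It is induced by antichains if $X_{-1}=\varnothing$ and $X_n-X_{n-1}$ is an antichain for every $n\in\mathbb{N}$. Colorings: view $X$ as a category (one arrow $x\to y$ for each $x\le y$) and a group $G$ as a one-object category. An admissible $G$-coloring of $X$ is a functor $c:X\to G$, i.e. an assignment of $c(x\le y)\in G$ to every relation $x\le y$ with $c(x\le x)=1$ and $c(x\le z)=c(x\le y)\,c(y\le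 z)$ for $x\le y\le z$. It is connected if the induced functor $X[\mathrm{Mor}(X)^{-1}]\to G$ from the localization of $X$ at all its arrows is full. $E(c)$ is the poset $\{(x,g):x\in X,\ g\in G\}$ with $(x,g)\preceq(y,g\cdot c(x\le y))$ whenever $x\le y$; for a connected coloring the projection $E(c)\to X$ is a regular covering with deck transformation group $G$. A coloring $c:X\to\pi_1(X)$ corresponds to the universal cover if $E(c)\to X$ is the universal cover of $X$. In the case $p=1$: for $x\in D_1$, $\hat C_x^{X_1}\times G$ (with the subspace topology from $E(c)$) is the disjoint union over $g\in G$ of the subposets $\hat C_{(x,g)}^{X_1\times G}=\{(y,g\cdot c(x\le y)):y\in\hat C_x^{X_1}\}$, each isomorphic to $\hat C_x^{X_1}$ via $(y,h)\mapsto y$; the summand $\tilde H_q(\hat C_x^{X_1})$ indexed by $(x,g)$ is identified with $\tilde H_q(\hat C_{(x,g)}^{X_1\times G})$ in this way and mapped to $H_q(X_0\times G)$ by the inclusion. *)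

(* Defs.v *)
From HB Require Import structures.
From mathcomp Require Import all_boot all_order all_algebra ring_quotient.
From mathcomp Require Import all_classical all_reals topology normedtype.
From mathcomp.multinomials Require Import freeg.

Set Implicit Arguments.
Unset Strict Implicit.
Unset Printing Implicit Defensive.

Import Order.TTheory GRing.Theory Num.Theory.
Import numFieldNormedType.Exports.

Local Open Scope classical_set_scope.
Local Open Scope ring_scope.

Section Subquotient.
Variables (V : zmodType) (Z B : zmodClosed V).

Record zsub := Zsub { zsub_val : V; zsub_valP : zsub_val \in Z }.

HB.instance Definition _ := [isSub for zsub_val].
HB.instance Definition _ := [Choice of zsub by <:].
HB.instance Definition _ := [SubChoice_isSubZmodule of zsub by <:].

Definition zsub_in : {pred zsub} := [pred u | zsub_val u \in B].

Lemma zsub_in_closed : zmod_closed zsub_in.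
Proof.
split=> [|u v uB vB].
  by rewrite unfold_in -[zsub_val _]/(val _) raddf0 rpred0.
by rewrite unfold_in -[zsub_val _]/(val _) raddfB; exact: rpredB uB vB.
Qed.

HB.instance Definition _ := GRing.isZmodClosed.Build zsub zsub_in zsub_in_closed.

(* Z / (Z :&: B); in all uses B is contained in Z. *)
Definition subquot := Quotient.quot zsub_in.
HB.instance Definition _ := GRing.Zmodule.on subquot.

(* The class of v; it is only meaningful for v in Z. *)
Definition sqclass (v : V) : subquot :=
  if insub v is Some u then \pi_(Quotient.quot zsub_in)%qT u else 0.

Lemma sqclassE (v : V) (vZ : v \in Z) :
  sqclass v = \pi_(Quotient.quot zsub_in)%qT (Zsub vZ).
Proof.
rewrite /sqclass; case: insubP => [u _ uv|/negP//].
by congr (\pi _)%qT; exact: val_inj.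
Qed.

Lemma sqclassB (u v : V) : u \in Z -> v \in Z ->
  sqclass (u - v) = sqclass u - sqclass v.
Proof.
move=> uZ vZ; rewrite (sqclassE uZ) (sqclassE vZ) (sqclassE (rpredB uZ vZ)).
rewrite [X in \pi_(_)%qT X](_ : _ = Zsub uZ - Zsub vZ); last first.
  by apply: val_inj; rewrite raddfB.
by rewrite pi_addr pi_oppr.
Qed.

Lemma sqclass0 : sqclass 0 = 0.
Proof. by rewrite -(subrr 0) sqclassB ?rpred0 // subrr. Qed.

End Subquotient.

Arguments sqclass {V} Z B v.

Section KernelImage.
Variables (U V : zmodType) (f : {additive U -> V}).

Definition zker : {pred U} := [pred u | f u == 0].
Definition zimg : {pred V} := [pred v | `[< exists u, v = f u >]].

Lemma zker_closed : zmod_closed zker.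
Proof.
split=> [|u v]; rewrite !inE ?raddf0 // => /eqP fu /eqP fv.
by rewrite raddfB fu fv subr0.
Qed.

Lemma zimg_closed : zmod_closed zimg.
Proof.
split=> [|u v]; first by apply/asboolP; exists 0; rewrite raddf0.
move=> /asboolP[a ->] /asboolP[b ->]; apply/asboolP.
by exists (a - b); rewrite raddfB.
Qed.

HB.instance Definition _ := GRing.isZmodClosed.Build U zker zker_closed.
HB.instance Definition _ := GRing.isZmodClosed.Build V zimg zimg_closed.

End KernelImage.

Section DirectSum.
Variables (I : choiceType) (M : I -> zmodType).

Record dsum := Dsum {
  dsum_val :> forall i, M i;
  dsum_fin : finite_set [set i | dsum_val i != 0] }.

Lemma dsumP (u v : dsum) : (forall i, u i = v i) -> u = v.
Proof.
case: u v => [u Pu] [v Pv] /= uv.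
have {}uv : u = v by apply: functional_extensionality_dep.
by case: _ / uv in Pv *; rewrite (Prop_irrelevance Pu Pv).
Qed.

Lemma dsum_zero_fin : finite_set [set i : I | (0 : M i) != 0].
Proof.
by rewrite (_ : [set _ | _] = set0) // -subset0 => i /=; rewrite eqxx.
Qed.

Lemma dsum_opp_fin (u : dsum) : finite_set [set i | - u i != 0].
Proof. by apply: sub_finite_set (dsum_fin u) => i /=; rewrite oppr_eq0. Qed.

Lemma dsum_add_fin (u v : dsum) : finite_set [set i | u i + v i != 0].
Proof.
have : finite_set ([set i | u i != 0] `|` [set i | v i != 0]).
  by rewrite finite_setU; split; exact: dsum_fin.
apply: sub_finite_set => i /= uvi.
have [ui0|] := eqVneq (u i) 0; last by left.
by right; move: uvi; rewrite ui0 add0r.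
Qed.

HB.instance Definition _ := gen_eqMixin dsum.
HB.instance Definition _ := gen_choiceMixin dsum.

Let dsum_addA : associative (fun u v => Dsum (dsum_add_fin u v)).
Proof. by move=> u v w; apply: dsumP => i /=; rewrite addrA. Qed.
Let dsum_addC : commutative (fun u v => Dsum (dsum_add_fin u v)).
Proof. by move=> u v; apply: dsumP => i /=; rewrite addrC. Qed.
Let dsum_add0 :
  left_id (Dsum dsum_zero_fin) (fun u v => Dsum (dsum_add_fin u v)).
Proof. by move=> u; apply: dsumP => i /=; rewrite add0r. Qed.
Let dsum_addN : left_inverse (Dsum dsum_zero_fin)
  (fun u => Dsum (dsum_opp_fin u)) (fun u v => Dsum (dsum_add_fin u v)).
Proof. by move=> u; apply: dsumP => i /=; rewrite addNr. Qed.

HB.instance Definition _ := GRing.isZmodule.Build dsum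
  dsum_addA dsum_addC dsum_add0 dsum_addN.

Lemma dsum_inc_fin (i : I) (m : M i) :
  finite_set [set j | dfwith (fun k : I => 0 : M k) i m j != 0].
Proof.
apply: (@sub_finite_set _ _ [set i]); last exact: finite_set1.
by move=> j /=; case: dfwithP => // k ik; rewrite eqxx.
Qed.

Definition dsum_inc (i : I) (m : M i) : dsum := Dsum (dsum_inc_fin m).

End DirectSum.

Arguments dsum_inc {I} M i m.

Section Homology.
Context {d : Order.disp_t} {T : porderType d}.

(* The flag [aug] selects the augmented complex, which computes reduced
   homology: there the empty chain generates degree -1. A chain is the
   increasing sequence of its elements. *)
Definition is_chain (aug : bool) (A : set T) (n : int) (s : seq T) : bool :=
  [&& sorted <%O s, (size s)%:Z == n + 1, all (fun x => x \in A) s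
    & aug || (s != [::])].

Definition face_sum (aug : bool) (s : seq T) : {freeg (seq T)} :=
  if aug || (1 < size s)%N then
    \sum_(i < size s) (-1) ^+ i *: << take i s ++ drop i.+1 s >>
  else 0.

Definition bd (aug : bool) (z : {freeg (seq T)}) : {freeg (seq T)} :=
  fglift (face_sum aug) z.

Definition chains (aug : bool) (A : set T) (n : int) : {pred {freeg (seq T)}} :=
  [pred z | all (is_chain aug A n) (dom z)].

Definition cycles (aug : bool) (A : set T) (n : int) : {pred {freeg (seq T)}} :=
  [pred z | (z \in chains aug A n) && (bd aug z == 0)].

Definition boundaries (aug : bool) (A : set T) (n : int) :
    {pred {freeg (seq T)}} :=
  [pred z | `[< exists2 w, w \in chains aug A (n + 1) & z = bd aug w >]].

Lemma chains_closed aug A n : zmod_closed (chains aug A n).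
Proof.
split=> [|u v]; rewrite !inE; first by rewrite dom0.
move=> /allP uA /allP vA; apply/allP => s /domB.
by rewrite mem_cat => /orP[/uA|/vA].
Qed.

HB.instance Definition _ aug A n :=
  GRing.isZmodClosed.Build _ (chains aug A n) (chains_closed aug A n).

Lemma bd_additive aug : additive (bd aug).
Proof. exact: lift_is_additive. Qed.

HB.instance Definition _ aug :=
  GRing.isAdditive.Build _ _ (bd aug) (bd_additive aug).

Lemma bdB aug u v : bd aug (u - v) = bd aug u - bd aug v.
Proof. exact: bd_additive. Qed.

Lemma bd0 aug : bd aug 0 = 0.
Proof. exact: raddf0. Qed.

Lemma cycles_closed aug A n : zmod_closed (cycles aug A n).
Proof.
split=> [|u v]; first by apply/andP; rewrite rpred0 bd0.
move=> /andP[uA /eqP du] /andP[vA /eqP dv]; apply/andP; split.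
  exact: (rpredB uA vA).
by rewrite bdB du dv subr0.
Qed.

HB.instance Definition _ aug A n :=
  GRing.isZmodClosed.Build _ (cycles aug A n) (cycles_closed aug A n).

Lemma boundaries_closed aug A n : zmod_closed (boundaries aug A n).
Proof.
split=> [|u v].
  by apply/asboolP; exists 0; rewrite ?rpred0 ?bd0.
move=> /asboolP[a aA ->] /asboolP[b bA ->]; apply/asboolP.
by exists (a - b); rewrite ?bdB // rpredB.
Qed.

HB.instance Definition _ aug A n :=
  GRing.isZmodClosed.Build _ (boundaries aug A n) (boundaries_closed aug A n).

Definition homology (aug : bool) (A : set T) (n : int) : zmodType :=
  subquot (cycles aug A n) (boundaries aug A n).

Definition hclass (aug : bool) (A : set T) (n : int) (z : {freeg (seq T)}) :
    homology aug A n :=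
  sqclass (cycles aug A n) (boundaries aug A n) z.

Definition sgn (s : seq T) (y : T) : int := (-1) ^+ index y s.

(* C_x^A and \hat C_x^A *)
Definition Cset (A : set T) (x : T) : set T := [set a | A a /\ (a >=< x)%O].
Definition hatC (A : set T) (x : T) : set T := Cset A x `\ x.

Definition locally_finite : Prop := forall x : T, finite_set [set a | (a <= x)%O].

Definition antichain (A : set T) : Prop :=
  forall x y, A x -> A y -> (x <= y)%O -> x = y.

Definition is_filtration (Xf : int -> set T) : Prop :=
  (forall p q, p <= q -> Xf p `<=` Xf q) /\ \bigcup_p Xf p = setT.

Definition layer (Xf : int -> set T) (p : int) : set T := Xf p `\` Xf (p - 1).

Definition induced_by_antichains (Xf : int -> set T) : Prop :=
  Xf (-1) = set0 /\ forall n : nat, (0 < n)%N -> antichain (layer Xf n%:Z).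

End Homology.

Arguments locally_finite {d} T.

(* Open sets are the down-sets, so that the minimal open neighbourhood of x is
   U_x = {a <= x}. *)
Definition alexandroff {d : Order.disp_t} (T : porderType d) : Type := T.

Section Alexandroff.
Context {d : Order.disp_t} (T : porderType d).

HB.instance Definition _ := Choice.on (alexandroff T).

Definition down_closed : set_system (alexandroff T) :=
  [set A | forall x y : T, (x <= y)%O -> A y -> A x].

Lemma down_closedT : down_closed setT.
Proof. by []. Qed.

Lemma down_closedI : setI_closed down_closed.
Proof. by move=> A B dA dB x y xy [/(dA _ _ xy) ? /(dB _ _ xy) ?]. Qed.

Lemma down_closed_bigU (I : Type) (f : I -> set (alexandroff T)) :
  (forall i, down_closed (f i)) -> down_closed (\bigcup_i f i).
Proof. by move=> df x y xy [i _ /(df i _ _ xy)]; exists i. Qed.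

HB.instance Definition _ := isOpenTopological.Build (alexandroff T)
  down_closedT down_closedI down_closed_bigU.

End Alexandroff.

Section Homotopy.
Context {R : realType} {T : topologicalType}.
Implicit Types (x y : T) (u v : R -> T).

(* A path is a function on R of which only the values on [0, 1] matter. *)
Definition is_path x y u : Prop :=
  [/\ {within `[0, 1], continuous u}, u 0 = x & u 1 = y].

Definition path_cat u v : R -> T :=
  fun t => if t <= 2^-1 then u (2 * t) else v (2 * t - 1).

Definition path_homotopic u v : Prop :=
  exists h : R * R -> T,
    [/\ {within `[0, 1] `*` `[0, 1], continuous h},
        (forall t, t \in `[0, 1] -> h (t, 0) = u t /\ h (t, 1) = v t)
      & (forall s, s \in `[0, 1] -> h (0, s) = u 0 /\ h (1, s) = u 1)].

End Homotopy.

(* G is isomorphic to pi_1(T, x0): [phi] identifies the homotopy classes of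
   loops at x0 with the elements of G, concatenation becoming the product. *)
Definition is_pi1 (R : realType) (T : topologicalType) (x0 : T)
    (G : groupType) : Prop :=
  exists phi : (R -> T) -> G,
    [/\ (forall u v, is_path x0 x0 u -> is_path x0 x0 v ->
           phi (path_cat u v) = (phi u * phi v)%g),
        (forall u v, is_path x0 x0 u -> is_path x0 x0 v ->
           phi u = phi v <-> path_homotopic u v)
      & (forall g, exists2 u, is_path x0 x0 u & phi u = g)].

Definition simply_connected (R : realType) (T : topologicalType) : Prop :=
  (forall x y : T, exists u : R -> T, is_path x y u) /\
  (forall (x : T) (u : R -> T), is_path x x u -> path_homotopic u (cst x)).

Definition evenly_covered (E B : topologicalType) (f : E -> B) (U : set B) :
    Prop :=
  exists (I : Type) (V : I -> set E),
    [/\ (forall i, open (V i)), trivIset setT V, f @^-1` U = \bigcup_i V i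
      & (forall i, set_bij (V i) U f /\
           forall W, open W -> W `<=` V i -> open (f @` W))].

Definition covering_map (E B : topologicalType) (f : E -> B) : Prop :=
  continuous f /\
  forall b, exists U : set B, [/\ open U, U b & evenly_covered f U].

Definition universal_cover (R : realType) (E B : topologicalType) (f : E -> B) :
    Prop :=
  covering_map f /\ simply_connected R E.

Section Coloring.
Context {d : Order.disp_t} (X : porderType d) (G : groupType).

(* [col x y] stands for c(x <= y); its value is irrelevant unless x <= y. *)
Record coloring := Coloring {
  col :> X -> X -> G;
  col_refl : forall x, col x x = 1%g;
  col_trans : forall x y z, (x <= y)%O -> (y <= z)%O ->
    col x z = (col x y * col y z)%g }.

(* c extended to all comparable pairs by c(b <= a) = c(a <= b)^-1 *)
Definition colx (c : coloring) (x y : X) : G :=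
  if (x <= y)%O then c x y else ((c y x)^-1)%g.

(* Arrows x -> y of the localization X[Mor(X)^-1]: zigzags, i.e. words in the
   arrows of X and their formal inverses, modulo [zz_equiv]. *)
Inductive zigzag (x : X) : X -> Type :=
| zz_nil : zigzag x x
| zz_fwd y z of zigzag x y & (y <= z)%O : zigzag x z
| zz_bwd y z of zigzag x y & (z <= y)%O : zigzag x z.

Inductive zz_equiv (x : X) : forall y, zigzag x y -> zigzag x y -> Prop :=
| zz_refl y (w : zigzag x y) : zz_equiv w w
| zz_sym y (w w' : zigzag x y) : zz_equiv w w' -> zz_equiv w' w
| zz_trans y (w w' w'' : zigzag x y) :
    zz_equiv w w' -> zz_equiv w' w'' -> zz_equiv w w''
| zz_fwd_congr y z (w w' : zigzag x y) (yz : (y <= z)%O) :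
    zz_equiv w w' -> zz_equiv (zz_fwd w yz) (zz_fwd w' yz)
| zz_bwd_congr y z (w w' : zigzag x y) (zy : (z <= y)%O) :
    zz_equiv w w' -> zz_equiv (zz_bwd w zy) (zz_bwd w' zy)
| zz_id y (w : zigzag x y) (yy : (y <= y)%O) : zz_equiv (zz_fwd w yy) w
| zz_comp y z t (w : zigzag x y) (yz : (y <= z)%O) (zt : (z <= t)%O)
    (yt : (y <= t)%O) :
    zz_equiv (zz_fwd (zz_fwd w yz) zt) (zz_fwd w yt)
| zz_fwdK y z (w : zigzag x y) (yz : (y <= z)%O) :
    zz_equiv (zz_bwd (zz_fwd w yz) yz) w
| zz_bwdK y z (w : zigzag x y) (zy : (z <= y)%O) :
    zz_equiv (zz_fwd (zz_bwd w zy) zy) w.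

Fixpoint zz_color (c : coloring) x y (w : zigzag x y) : G :=
  match w with
  | zz_nil => 1
  | zz_fwd y z w' _ => zz_color c w' * c y z
  | zz_bwd y z w' _ => zz_color c w' * (c z y)^-1
  end%g.

Lemma zz_color_equiv (c : coloring) x y (w w' : zigzag x y) :
  zz_equiv w w' -> zz_color c w = zz_color c w'.
Proof.
elim=> //=.
- by move=> ? ? ? ? _ -> _ ->.
- by move=> ? ? ? ? ? _ ->.
- by move=> ? ? ? ? ? _ ->.
- by move=> ? ? _; rewrite col_refl mulg1.
- by move=> ? ? ? ? yz zt _; rewrite (col_trans c yz zt) mulgA.
- by move=> ? ? ? _; rewrite mulgK.
- by move=> ? ? ? _; rewrite mulgVK.
Qed.

Definition loc_hom (x y : X) : Type :=
  {C : set (zigzag x y) | exists w, C = [set w' | zz_equiv w w']}.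

Definition loc_class x y (w : zigzag x y) : loc_hom x y :=
  exist _ [set w' | zz_equiv w w'] (ex_intro _ w erefl).

(* The value on a class is computed on a chosen representative; see [loc_colorE]
   for independence of the choice. *)
Definition loc_color (c : coloring) x y (f : loc_hom x y) : G :=
  zz_color c (projT1 (cid (proj2_sig f))).

Lemma loc_colorE (c : coloring) x y (w : zigzag x y) :
  loc_color c (loc_class w) = zz_color c w.
Proof.
rewrite /loc_color; case: cid => w' /= e; apply: zz_color_equiv.
have : [set v | zz_equiv w v] w by exact: zz_refl.
by rewrite e.
Qed.

Definition connected_coloring (c : coloring) : Prop :=
  forall (x y : X) (g : G), exists f : loc_hom x y, loc_color c f = g.

End Coloring.

(* The poset E(c), ordered by [ecover_le]. *)
Definition ecover {d : Order.disp_t} {X : porderType d} {G : groupType}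
  (c : coloring X G) : Type := (X * G)%type.

Section ECover.
Context {d : Order.disp_t} {X : porderType d} {G : groupType}.
Variable c : coloring X G.

HB.instance Definition _ := Choice.on (ecover c).

Definition ecover_le (u v : ecover c) : bool :=
  (u.1 <= v.1)%O && (v.2 == u.2 * c u.1 v.1)%g.

Definition ecover_lt (u v : ecover c) : bool := (v != u) && ecover_le u v.

Let ecover_lt_def u v : ecover_lt u v = (v != u) && ecover_le u v.
Proof. by []. Qed.

Let ecover_refl : reflexive ecover_le.
Proof. by case=> x g; rewrite /ecover_le /= lexx col_refl mulg1 eqxx. Qed.

Let ecover_anti : antisymmetric ecover_le.
Proof.
case=> x g [y h]; rewrite /ecover_le /= => /andP[/andP[xy /eqP ->] /andP[yx _]].
have -> : y = x by apply/eqP; rewrite eq_le xy yx.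
by rewrite col_refl mulg1.
Qed.

Let ecover_trans : transitive ecover_le.
Proof.
case=> y h [x g] [z k]; rewrite /ecover_le /= => /andP[xy /eqP ->].
move=> /andP[yz /eqP ->]; rewrite (le_trans xy yz) /=.
by rewrite (col_trans c xy yz) mulgA.
Qed.

HB.instance Definition _ := Order.isPOrder.Build d (ecover c)
  ecover_lt_def ecover_refl ecover_anti ecover_trans.

Definition ecover_proj (u : alexandroff (ecover c)) : alexandroff X := u.1.

(* \hat C_x -> E(c), y |-> (y, g c(x <= y)), applied to a chain of \hat C_x *)
Definition ecover_lift (g : G) (x : X) (s : seq X) : seq (ecover c) :=
  [seq ((y, (g * colx c x y)%g) : ecover c) | y <- s].

(* A x G as a subspace of E(c) *)
Definition ecover_on (A : set X) : set (ecover c) := [set u | A u.1].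

End ECover.

Arguments ecover_proj {d X G} c u.
Arguments ecover_lift {d X G} c g x s.
Arguments ecover_on {d X G} c A.

(* Only the pages r >= 1 are meaningful; page 0 is unconstrained. The
   differential d^r_{p,q} is [ss_d r p q (p - r) (q + r - 1)]; for other
   targets [ss_d] is zero. *)
Record spectral_sequence := SpectralSequence {
  page : nat -> int -> int -> zmodType;
  ss_d : forall r p q p' q', {additive page r p q -> page r p' q'};
  ss_shape : forall r p q p' q' (e : page r p q), (0 < r)%N ->
    ~ (p' = p - r%:Z /\ q' = q + r%:Z - 1) -> ss_d r p q p' q' e = 0;
  ss_dd : forall r p q p' q' p'' q'' (e : page r p q), (0 < r)%N ->
    ss_d r p' q' p'' q'' (ss_d r p q p' q' e) = 0;
  ss_turn : forall r p q,
    {additive subquot (zker (ss_d r p q (p - r%:Z) (q + r%:Z - 1)))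
                      (zimg (ss_d r (p + r%:Z) (q - r%:Z + 1) p q))
              -> page r.+1 p q};
  ss_turn_bij : forall r p q, (0 < r)%N -> bijective (ss_turn r p q) }.

Section Convergence.
Variable S : spectral_sequence.

(* [survives x y]: x in E^1 survives to page r+1, where it represents y *)
Fixpoint survives (p q : int) (r : nat) :
    page S 1 p q -> page S r.+1 p q -> Prop :=
  match r return page S 1 p q -> page S r.+1 p q -> Prop with
  | 0%N => fun x y => x = y
  | r'.+1 => fun x y => exists z : page S r'.+1 p q,
      [/\ survives x z,
          z \in zker (ss_d S r'.+1 p q (p - r'.+1%:Z) (q + r'.+1%:Z - 1))
        & y = ss_turn S r'.+1 p q (sqclass _ _ z)]
  end.

(* Z^oo and B^oo as subgroups of E^1. The terms E^r_{p,q} need not be eventually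
   constant in r, so E^oo is Z^oo / B^oo and not E^r for r large. *)
Definition perm_cycles (p q : int) : {pred page S 1 p q} :=
  [pred x | `[< forall r, exists y : page S r.+1 p q, survives x y >]].
Definition perm_bounds (p q : int) : {pred page S 1 p q} :=
  [pred x | `[< exists r, @survives p q r x 0 >]].

Lemma survives_sub p q r x x' y y' :
  @survives p q r x y -> @survives p q r x' y' ->
  @survives p q r (x - x') (y - y').
Proof.
elim: r y y' => [|r IH] /= y y'; first by move=> -> ->.
move=> [z [xz zk ->]] [z' [xz' zk' ->]]; exists (z - z').
split; [exact: IH | exact: rpredB zk zk' |].
by rewrite -raddfB; congr (ss_turn _ _ _ _ _); rewrite sqclassB.
Qed.

Lemma survives0 p q r : @survives p q r 0 0.
Proof.
elim: r => [//|r IH] /=; exists 0; split=> //; first exact: rpred0.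
by rewrite sqclass0 raddf0.
Qed.

Lemma survives_zeroS p q r x : @survives p q r x 0 -> @survives p q r.+1 x 0.
Proof.
move=> x0 /=; exists 0; split=> //; first exact: rpred0.
by rewrite sqclass0 raddf0.
Qed.

Lemma survives_zero_le p q r r' x :
  (r <= r')%N -> @survives p q r x 0 -> @survives p q r' x 0.
Proof.
move=> /subnK <- x0; elim: (r' - r)%N => // k IH.
by rewrite addSn; exact: survives_zeroS.
Qed.

Lemma perm_cycles_closed p q : zmod_closed (@perm_cycles p q).
Proof.
split=> [|u v]; first by apply/asboolP => r; exists 0; exact: survives0.
move=> /asboolP su /asboolP sv; apply/asboolP => r.
have [[y uy] [z vz]] := (su r, sv r).
by exists (y - z); exact: survives_sub.
Qed.

Lemma perm_bounds_closed p q : zmod_closed (@perm_bounds p q).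
Proof.
split=> [|u v]; first by apply/asboolP; exists 0%N; exact: survives0.
move=> /asboolP[a ua] /asboolP[b vb]; apply/asboolP; exists (maxn a b).
rewrite -[X in survives _ X](subr0 0).
apply: survives_sub.
  exact: survives_zero_le (leq_maxl a b) ua.
exact: survives_zero_le (leq_maxr a b) vb.
Qed.

HB.instance Definition _ p q :=
  GRing.isZmodClosed.Build _ (@perm_cycles p q) (perm_cycles_closed p q).
HB.instance Definition _ p q :=
  GRing.isZmodClosed.Build _ (@perm_bounds p q) (perm_bounds_closed p q).

Definition page_infty (p q : int) : zmodType :=
  subquot (@perm_cycles p q) (@perm_bounds p q).

(* Each H n has a finite filtration F n whose successive quotients are the
   terms of E^oo of total degree n. *)
Definition converges (H : int -> zmodType) : Prop :=
  exists F : forall n : int, int -> zmodClosed (H n),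
    [/\ (forall n p p', p <= p' -> {subset F n p <= F n p'}),
        (forall n, exists a b, (forall h, h \in F n a -> h = 0) /\
                               (forall h, h \in F n b))
      & (forall p q, exists f : {additive page_infty p q ->
           subquot (F (p + q)%R p) (F (p + q)%R (p - 1)%R)}, bijective f)].

End Convergence.

Section FirstPage.
Context {d : Order.disp_t} {X : porderType d} {G : groupType}.
Variables (Xf : int -> set X) (c : coloring X G).

Definition layer_index (p : int) : choiceType := (layer Xf p * G)%type.

Definition link_homology (p q : int) (i : layer_index p) : zmodType :=
  homology true (hatC (Xf p) (val i.1)) (p + q - 1).

Definition first_page (p q : int) : zmodType := dsum (@link_homology p q).

(* inc_{x,g}([z]) for z a cycle of \hat C_x^{X_p} *)
Definition inc (p q : int) (x : layer Xf p) (g : G) (z : {freeg (seq X)}) :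
    first_page p q :=
  dsum_inc (@link_homology p q) (x, g)
    (hclass true (hatC (Xf p) (val x)) (p + q - 1) z).

End FirstPage.

(* Main.v *)
Require Import Defs.
From HB Require Import structures.
From mathcomp Require Import all_boot all_order all_algebra ring_quotient.
From mathcomp Require Import all_classical all_reals topology normedtype.
From mathcomp.multinomials Require Import freeg.
From mathcomp Require Import zify lra.

(** The spectral sequence is the one of the chain complex of [E(c)], filtered by
    the chains lying over [X_p].

    Its first page is read off from the points of the layer [D_p]. As [D_p] is an
    antichain, a chain over [X_p] contains at most one point [(x, g)] over [D_p].
    Deleting that point, with the sign of its position, turns the chains through
    [(x, g)] into the chains of [\hat C_(x, g)], which the projection identifies
    with the chains of [\hat C_x] ([to_sheet], [to_base]). Deletion anticommutes
    with boundaries ([bd_link_coeff]) and is inverse to coning, so it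
    identifies [F_p / F_(p-1)] with the direct sum over [(x, g)] of the augmented
    complexes of the [\hat C_x], with a shift of degree by one ([link_iso]). The
    class of a cycle [z] at [(x, g)] is represented by the cone with apex [(x, g)]
    on the lift of [z]; the boundary of this cone is the lift itself, a
    cycle over [X_(p-1)] ([to_sheet_cycles]). Its class in [H(X_0 x G)], when
    [p = 1], or its coefficients at the points over [D_(p-1)], when [p >= 2], give
    the first differential ([link_rel_to_sheet]).

    The general theory of filtered complexes gives convergence once the filtration
    induced on each [H_n] of [E(c)] is finite ([filtered_ss_converges]). It is zero
    for [p < 0]. For [n >= 2] it is stationary where the links have no reduced
    homology in degree [n - 1] ([cover_filt_stationary]). For [n <= 1] the links
    give no information, and simple connectedness of [E(c)] is used instead: then
    [H_0] comes from any point, and [H_1 = 0]. The latter is a special case of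
    the theorem of Hurewicz, proved by integration. Sending an edge to its class
    modulo boundaries is an additive cocycle on the relations of the poset; such a
    cocycle can be integrated along continuous paths ([primitive_exists]), the
    integral only depends on the homotopy class ([homotopy_primitive]), so the
    cocycle has a potential ([simply_connected_potential]). Hence the class of a
    1-chain only depends on its boundary ([cycles1_boundary]). *)

Set Implicit Arguments.
Unset Strict Implicit.
Unset Printing Implicit Defensive.

Import Order.TTheory GRing.Theory Num.Theory.
Import numFieldNormedType.Exports.

Local Open Scope classical_set_scope.
Local Open Scope ring_scope.

(** * Subquotients and additive relations *)

Definition additive_of (U V : zmodType) (f : U -> V) (fB : additive f) :
    {additive U -> V} :=
  HB.pack f (GRing.isAdditive.Build U V f fB).

Lemma zero_additive (U W : zmodType) : additive (fun _ : U => 0 : W).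
Proof. by move=> u v; rewrite subrr. Qed.

Section SubquotientTheory.
Variables (V : zmodType) (Z B : zmodClosed V).

Lemma sqclass_surj (u : subquot Z B) : exists2 v, v \in Z & u = sqclass Z B v.
Proof.
elim/quotW: u => -[v vZ]; exists v => //.
by rewrite (sqclassE _ vZ).
Qed.

Lemma sqclass_eq0 v : v \in Z -> (sqclass Z B v == 0) = (v \in B).
Proof.
move=> vZ; rewrite sqclassE -(sqclass0 Z B) (sqclassE _ (rpred0 Z)).
rewrite -Quotient.idealrBE.
by rewrite [LHS]unfold_in /= subr0.
Qed.

Lemma sqclass_eq u v : u \in Z -> v \in Z ->
  sqclass Z B u = sqclass Z B v <-> u - v \in B.
Proof.
move=> uZ vZ; rewrite -sqclass_eq0 ?rpredB// sqclassB//.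
by split=> [->|]; rewrite ?subrr// subr_eq0 => /eqP.
Qed.

Lemma sqclassN v : v \in Z -> sqclass Z B (- v) = - sqclass Z B v.
Proof. by move=> vZ; rewrite -sub0r sqclassB ?rpred0// sqclass0 sub0r. Qed.

End SubquotientTheory.

(** Maps between subquotients are specified here by naming a common
    representative of the argument and of the value. Such a correspondence is
    the graph of an isomorphism as soon as it is additive, total, surjective and
    has trivial kernels on both sides; no choice of representatives has to be
    shown irrelevant. The turning of pages, the comparison with the limit page and
    the description of the first page are all obtained in this way. *)
Lemma additive_relation_iso (U W : zmodType) (Rel : U -> W -> Prop) :
  (forall u u' w w', Rel u w -> Rel u' w' -> Rel (u - u') (w - w')) ->
  (forall u, exists w, Rel u w) -> (forall w, exists u, Rel u w) ->
  (forall w, Rel 0 w -> w = 0) -> (forall u, Rel u 0 -> u = 0) ->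
  {f : {additive U -> W} | bijective f /\ forall u w, Rel u w <-> w = f u}.
Proof.
move=> RB Rl Rr R0l R0r.
pose f u := projT1 (cid (Rl u)); pose g w := projT1 (cid (Rr w)).
have Rf u : Rel u (f u) by rewrite /f; case: cid.
have Rg w : Rel (g w) w by rewrite /g; case: cid.
have RE u w : Rel u w <-> w = f u.
  split=> [uw|->//]; apply/eqP; rewrite -subr_eq0; apply/eqP/R0l.
  by rewrite -(subrr u); exact: RB.
have fB : additive f by move=> u v; apply/esym/RE; exact: RB.
exists (additive_of fB); split=> //; exists g => [u|w] /=; last exact/esym/RE.
apply/eqP; rewrite -subr_eq0; apply/eqP/R0r.
by rewrite -(subrr (f u)); apply: RB.
Qed.

(** * The spectral sequence of a filtered complex *)

Section FilteredComplex.
Variables (V : zmodType) (D : {additive V -> V}).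
Variable F : int -> int -> zmodClosed V.
Hypothesis DD : forall v, D (D v) = 0.
Hypothesis F_le : forall p p' n, p <= p' -> {subset F p n <= F p' n}.

(** [Z^r_p], the elements of [F_p] whose boundary drops by [r] steps, and
    below [B^r_p = Z^(r-1)_(p-1) + d Z^(r-1)_(p+r-1)]. The index [r] is an
    integer, so that [r - 1] keeps its meaning on page 0. *)
Definition approx_cycles (r p n : int) : {pred V} :=
  [pred v | (v \in F p n) && (D v \in F (p - r) (n - 1))].

Definition approx_bounds (r p n : int) : {pred V} :=
  [pred v | `[< exists a b, [/\ a \in approx_cycles (r - 1) (p - 1) n,
    b \in approx_cycles (r - 1) (p + r - 1) (n + 1) & v = a + D b] >]].

Lemma approx_cycles_closed r p n : zmod_closed (approx_cycles r p n).
Proof.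
split=> [|u v]; rewrite !inE ?raddf0 ?rpred0//.
by move=> /andP[uF Du] /andP[vF Dv]; rewrite raddfB !rpredB.
Qed.

HB.instance Definition _ r p n := GRing.isZmodClosed.Build V
  (approx_cycles r p n) (approx_cycles_closed r p n).

Lemma approx_bounds_closed r p n : zmod_closed (approx_bounds r p n).
Proof.
split=> [|u v].
  by apply/asboolP; exists 0, 0; rewrite !rpred0 raddf0 addr0.
move=> /asboolP[a [b [aZ bZ ->]]] /asboolP[a' [b' [aZ' bZ' ->]]].
apply/asboolP; exists (a - a'), (b - b'); split; rewrite ?rpredB//.
by rewrite raddfB opprD addrACA.
Qed.

HB.instance Definition _ r p n := GRing.isZmodClosed.Build V
  (approx_bounds r p n) (approx_bounds_closed r p n).

Lemma approx_cyclesP r p n v : reflect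
  (v \in F p n /\ D v \in F (p - r) (n - 1)) (v \in approx_cycles r p n).
Proof. exact: andP. Qed.

Lemma approx_boundsP r p n v : reflect
  (exists a b, [/\ a \in approx_cycles (r - 1) (p - 1) n,
    b \in approx_cycles (r - 1) (p + r - 1) (n + 1) & v = a + D b])
  (v \in approx_bounds r p n).
Proof. exact: asboolP. Qed.

Definition fpage (r : nat) (p q : int) : zmodType :=
  subquot (approx_cycles r p (p + q)) (approx_bounds r p (p + q)).

Definition fclass (r : nat) (p q : int) (v : V) : fpage r p q :=
  sqclass (approx_cycles r p (p + q)) (approx_bounds r p (p + q)) v.

Lemma approx_cycles_D r p n p' n' v : p' = p - r -> n' = n - 1 ->
  v \in approx_cycles r p n -> D v \in approx_cycles r p' n'.
Proof.
by move=> -> -> /approx_cyclesP[_ Dv]; apply/approx_cyclesP; rewrite DD rpred0.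
Qed.

Lemma approx_bounds_D r p n p' n' v : p' = p - r -> n' = n - 1 ->
  v \in approx_bounds r p n -> D v \in approx_bounds r p' n'.
Proof.
move=> -> -> /approx_boundsP[a [b [/approx_cyclesP[aF Da] _ ->]]].
rewrite raddfD DD addr0; apply/approx_boundsP; exists 0, a.
rewrite rpred0 add0r; split=> //; apply/approx_cyclesP.
rewrite (_ : p - r + r - 1 = p - 1) 1?(_ : n - 1 + 1 = n); [|lia|lia].
by split=> //; rewrite (_ : p - 1 - (r - 1) = p - r)//; lia.
Qed.

(** A differential is attached to every target, being zero off the diagonal:
    degrees that are only provably equal then never occur in types. *)
Definition is_target (r p q p' q' : int) : bool :=
  (p' == p - r) && (q' == q + r - 1).

Definition fdiff_rep (r : nat) (p q p' q' : int) (u : fpage r p q) :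
    fpage r p' q' :=
  if is_target r p q p' q'
  then fclass r p' q' (D (projT1 (cid2 (sqclass_surj u)))) else 0.

Lemma fdiff_repE (r : nat) (p q p' q' : int) v : is_target r p q p' q' ->
  v \in approx_cycles r p (p + q) ->
  fdiff_rep p' q' (fclass r p q v) = fclass r p' q' (D v).
Proof.
move=> t vZ; rewrite /fdiff_rep t; case: cid2 => w /= wZ /esym.
have [/eqP p'E /eqP q'E] := andP t.
move=> /(sqclass_eq _ wZ vZ) wv.
apply/sqclass_eq; [apply: approx_cycles_D wZ|apply: approx_cycles_D vZ|];
  try lia.
by rewrite -raddfB; apply: approx_bounds_D wv; lia.
Qed.

Lemma fdiff_additive r p q p' q' : additive (@fdiff_rep r p q p' q').
Proof.
move=> u v; have [t|/negbTE t] := boolP (is_target r p q p' q'); last first.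
  by rewrite /fdiff_rep t subrr.
have [u' uZ ->] := sqclass_surj u; have [v' vZ ->] := sqclass_surj v.
rewrite -sqclassB// !fdiff_repE ?rpredB// raddfB.
have [/eqP p'E /eqP q'E] := andP t.
by rewrite /fclass sqclassB//;
  [apply: approx_cycles_D uZ|apply: approx_cycles_D vZ]; lia.
Qed.

Definition fdiff r p q p' q' : {additive fpage r p q -> fpage r p' q'} :=
  additive_of (@fdiff_additive r p q p' q').

Lemma fdiffE (r : nat) (p q p' q' : int) v : p' = p - r%:Z -> q' = q + r%:Z - 1 ->
  v \in approx_cycles r p (p + q) ->
  fdiff r p q p' q' (fclass r p q v) = fclass r p' q' (D v).
Proof. by move=> -> ->; apply: fdiff_repE; rewrite /is_target !eqxx. Qed.

Lemma fdiff_shape (r : nat) (p q p' q' : int) (e : fpage r p q) : (0 < r)%N ->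
  ~ (p' = p - r%:Z /\ q' = q + r%:Z - 1) -> fdiff r p q p' q' e = 0.
Proof.
move=> _ nt; rewrite /= /fdiff_rep; case: ifP => // /andP[/eqP ? /eqP ?].
by case: nt.
Qed.

Lemma fdiff_dd (r : nat) (p q p' q' p'' q'' : int) (e : fpage r p q) :
  (0 < r)%N -> fdiff r p' q' p'' q'' (fdiff r p q p' q' e) = 0.
Proof.
move=> r0; have [/andP[/eqP p'E /eqP q'E]|/negP nt] :=
  boolP (is_target r p q p' q'); last first.
  rewrite (_ : fdiff r p q p' q' e = 0) ?raddf0//.
  by apply: fdiff_shape => // -[? ?]; apply: nt; apply/andP; split; apply/eqP.
have [/andP[/eqP p''E /eqP q''E]|/negP nt] :=
  boolP (is_target r p' q' p'' q''); last first.
  by rewrite fdiff_shape// => -[? ?]; apply: nt; apply/andP; split; apply/eqP.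
have [v vZ ->] := sqclass_surj e.
rewrite (fdiffE p'E q'E vZ) fdiffE ?DD//; first exact: sqclass0.
by apply: approx_cycles_D vZ; lia.
Qed.

Definition turned r p q :=
  subquot (zker (fdiff r p q (p - r%:Z) (q + r%:Z - 1)))
          (zimg (fdiff r (p + r%:Z) (q - r%:Z + 1) p q)).

Lemma approx_cyclesW r r' p n : r' <= r ->
  {subset approx_cycles r p n <= approx_cycles r' p n}.
Proof.
move=> rr' v /approx_cyclesP[vF Dv]; apply/approx_cyclesP; split=> //.
by apply: F_le Dv; lia.
Qed.

Lemma approx_cycles_le r p r' p' n : p <= p' -> p - r <= p' - r' ->
  {subset approx_cycles r p n <= approx_cycles r' p' n}.
Proof.
move=> pp' rr v /approx_cyclesP[vF Dv]; apply/approx_cyclesP; split.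
  exact: F_le vF.
exact: F_le Dv.
Qed.

Lemma approx_bounds_prev r p n :
  {subset approx_cycles (r - 1) (p - 1) n <= approx_bounds r p n}.
Proof.
move=> a aZ; apply/approx_boundsP.
by exists a, 0; rewrite aZ rpred0 raddf0 addr0.
Qed.

Lemma approx_cycles_ker (r : nat) p q v : v \in approx_cycles r.+1 p (p + q) ->
  fclass r p q v \in zker (fdiff r p q (p - r%:Z) (q + r%:Z - 1)).
Proof.
move=> vZ; have vZ' : v \in approx_cycles r p (p + q).
  by apply: approx_cyclesW vZ; lia.
rewrite inE fdiffE// sqclass_eq0//; last by apply: approx_cycles_D vZ'; lia.
apply/approx_bounds_prev/approx_cyclesP; rewrite DD rpred0; split=> //.
case/approx_cyclesP: vZ => _; congr (_ \in F _ _); lia.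
Qed.

(** If [d^r] kills the class of [v], then [D v = a + D w] with [a] one step
    deeper in the filtration, and [v - w] has boundary [a]. *)
Lemma ker_representative (r : nat) p q v : v \in approx_cycles r p (p + q) ->
  fclass r p q v \in zker (fdiff r p q (p - r%:Z) (q + r%:Z - 1)) ->
  exists2 w, w \in approx_cycles (r%:Z - 1) (p - 1) (p + q) &
    v - w \in approx_cycles r.+1 p (p + q).
Proof.
move=> vZ; rewrite inE fdiffE// sqclass_eq0; last first.
  by apply: approx_cycles_D vZ; lia.
move=> /approx_boundsP[a [b [/approx_cyclesP[aF Da] bZ DvE]]].
have bZ' : b \in approx_cycles (r%:Z - 1) (p - 1) (p + q).
  by move: bZ; congr (_ \in approx_cycles _ _ _); lia.
exists b => //; apply/approx_cyclesP; split.
  case/approx_cyclesP: vZ => vF _; case/approx_cyclesP: bZ' => bF _.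
  by apply: rpredB => //; apply: F_le bF; lia.
rewrite raddfB DvE addrK; move: aF; congr (_ \in F _ _); lia.
Qed.

Lemma fclass_prev (r : nat) p q v w : v \in approx_cycles r p (p + q) ->
  w \in approx_cycles (r%:Z - 1) (p - 1) (p + q) ->
  fclass r p q (v - w) = fclass r p q v.
Proof.
move=> vZ wZ; have wZ' : w \in approx_cycles r p (p + q).
  by apply: approx_cycles_le wZ; lia.
apply/sqclass_eq; [exact: rpredB|by []|rewrite addrAC subrr sub0r rpredN].
exact: approx_bounds_prev.
Qed.

Definition turn_rel (r : nat) p q (u : turned r p q) (w : fpage r.+1 p q) :=
  exists v, [/\ v \in approx_cycles r.+1 p (p + q),
    u = sqclass _ _ (fclass r p q v) & w = fclass r.+1 p q v].

(** The two correspondents are the classes of one element [v] of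
    [Z^(r+1)]: every class of the kernel of [d^r] has such a representative by
    [ker_representative]; and [v] lies in [B^(r+1)] exactly when its class on
    page [r] is hit by [d^r], because [B^(r+1)] is obtained from [B^r] by adding
    the boundaries of [Z^r] that arrive from [F_(p+r)]. *)
Lemma turn_iso (r : nat) p q :
  {f : {additive turned r p q -> fpage r.+1 p q} |
    bijective f /\ forall u w, @turn_rel r p q u w <-> w = f u}.
Proof.
have sub v : v \in approx_cycles r.+1 p (p + q) ->
    v \in approx_cycles r p (p + q) by apply: approx_cyclesW; lia.
apply: additive_relation_iso.
- move=> _ _ _ _ [v [vZ -> ->]] [v' [vZ' -> ->]]; exists (v - v').
  rewrite rpredB// /fclass -sqclassB ?approx_cycles_ker// -?sqclassB//.
  by rewrite sub. by rewrite sub.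
- move=> u; have [u' u'K ->] := sqclass_surj u.
  have [v vZ u'E] := sqclass_surj u'.
  rewrite {}u'E in u'K *.
  have [w wZ vwZ] := ker_representative vZ u'K.
  exists (fclass r.+1 p q (v - w)), (v - w); split=> //.
  by rewrite fclass_prev.
- move=> w; have [v vZ ->] := sqclass_surj w.
  by exists (sqclass _ _ (fclass r p q v)), v.
- move=> _ [v [vZ /esym/eqP + ->]].
  rewrite sqclass_eq0 ?approx_cycles_ker// => /asboolP[e].
  have [w wZ ->] := sqclass_surj e.
  rewrite fdiffE; [|lia|lia|by[]].
  have DwZ : D w \in approx_cycles r p (p + q).
    by apply: approx_cycles_D wZ; lia.
  move=> /(sqclass_eq _ (sub _ vZ) DwZ) /approx_boundsP[a [b [aZ bZ vE]]].
  have {}vE : v = a + D (w + b).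
    by rewrite raddfD addrCA -vE addrC subrK.
  apply/eqP; rewrite sqclass_eq0//; apply/approx_boundsP; exists a, (w + b).
  have wbF : w + b \in F (p + r.+1%:Z - 1) (p + q + 1).
    case/approx_cyclesP: wZ => wF _; case/approx_cyclesP: bZ => bF _.
    apply: rpredD.
      by move: wF; congr (_ \in F _ _); lia.
    by apply: F_le bF; lia.
  have aF : a \in F (p - 1) (p + q) by case/approx_cyclesP: aZ.
  have [vF DvF] := approx_cyclesP _ _ _ _ vZ.
  split=> //; apply/approx_cyclesP; split=> //.
    have -> : D a = D v by rewrite vE raddfD DD addr0.
    by move: DvF; congr (_ \in F _ _); lia.
  have -> : D (w + b) = v - a by rewrite vE [a + _]addrC addrK.
  rewrite (_ : p + r.+1%:Z - 1 - (r.+1%:Z - 1) = p); last lia.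
  rewrite addrK; apply: rpredB => //; apply: F_le aF; lia.
- move=> _ [v [vZ -> /esym/eqP]]; rewrite sqclass_eq0//.
  move=> /approx_boundsP[a [b [aZ bZ vE]]].
  apply/eqP; rewrite sqclass_eq0 ?approx_cycles_ker//; apply/asboolP.
  have bZ' : b \in approx_cycles r (p + r%:Z) (p + r%:Z + (q - r%:Z + 1)).
    by move: bZ; congr (_ \in approx_cycles _ _ _); lia.
  exists (fclass r _ _ b); rewrite fdiffE; [|lia|lia|by[]].
  have aZ' : a \in approx_cycles (r%:Z - 1) (p - 1) (p + q).
    by apply: approx_cyclesW aZ; lia.
  rewrite -(fclass_prev (sub _ vZ) aZ').
  by rewrite vE [a + _]addrC addrK.
Qed.

Definition filtered_ss : spectral_sequence := SpectralSequence
  fdiff_shape fdiff_dd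
  (fun r p q (_ : (0 < r)%N) => (projT2 (turn_iso r p q)).1).

End FilteredComplex.

(** * Convergence of a bounded filtration *)

Section FilteredConvergence.
Variables (V : zmodType) (D : {additive V -> V}).
Variable F : int -> int -> zmodClosed V.
Hypothesis DD : forall v, D (D v) = 0.
Hypothesis F_le : forall p p' n, p <= p' -> {subset F p n <= F p' n}.

Let S := filtered_ss DD F_le.
Local Notation fclass := (fclass D F).
Local Notation approx_cycles := (approx_cycles D F).
Local Notation approx_bounds := (approx_bounds D F).

(** Replacing [v] by the correction of [ker_representative] changes it by an
    element of [F_(p-1)], which is invisible on the first page. *)
Lemma survivesE p q r (x : page S 1 p q) (y : page S r.+1 p q) :
  survives x y <-> exists v, [/\ v \in approx_cycles r.+1 p (p + q),
    x = fclass 1 p q v & y = fclass r.+1 p q v].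
Proof.
elim: r y => [|r IH] y /=.
  split=> [->|[v [_ -> ->]]//]; have [v vZ ->] := sqclass_surj y.
  by exists v.
have sub k v : v \in approx_cycles k.+1 p (p + q) ->
  v \in approx_cycles k p (p + q) by apply: (approx_cyclesW F_le); lia.
have sub1 v : v \in approx_cycles r.+1 p (p + q) ->
  v \in approx_cycles 1 p (p + q) by apply: (approx_cyclesW F_le); lia.
split.
  move=> [z [/IH[v [vZ xE ->]] vK yE]].
  have [w wZ vwZ] := ker_representative F_le vZ vK.
  exists (v - w); split=> //.
    rewrite xE (fclass_prev F_le) ?sub1//.
    by apply: (approx_cycles_le F_le) wZ; lia.
  rewrite yE -(fclass_prev F_le vZ wZ); apply/esym.
  by apply/(projT2 (turn_iso DD F_le r.+1 p q)).2; exists (v - w).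
move=> [v [vZ xE yE]]; exists (fclass r.+1 p q v); split.
- by apply/IH; exists v; rewrite sub.
- exact: (approx_cycles_ker DD).
- by rewrite yE; apply/(projT2 (turn_iso DD F_le r.+1 p q)).2; exists v.
Qed.

Hypothesis F_neg : forall p n v, p < 0 -> v \in F p n -> v = 0.
Variables Zc Bc : int -> zmodClosed V.
Hypothesis ZcP : forall n v, v \in Zc n <-> exists2 p, v \in F p n & D v = 0.
Hypothesis BcP : forall n v, v \in Bc n <-> exists p w, w \in F p (n + 1) /\ v = D w.

(** As [F_p] vanishes for negative [p], an element of [Z^r_p] is a genuine
    cycle as soon as [r] exceeds [p]. *)
Lemma perm_cyclesE p q (x : page S 1 p q) : x \in @perm_cycles S p q <->
  exists v, [/\ v \in F p (p + q), D v = 0 & x = fclass 1 p q v].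
Proof.
split=> [/asboolP/(_ `|p|%N)[y /survivesE[v [/approx_cyclesP[vF Dv] xE _]]]|].
  by exists v; split=> //; apply: F_neg Dv; lia.
move=> [v [vF Dv xE]]; apply/asboolP => r; exists (fclass r.+1 p q v).
apply/survivesE; exists v; split=> //; apply/approx_cyclesP.
by rewrite Dv rpred0.
Qed.

(** A boundary [D b] in [F_p] comes from some stage [F_p'], so it dies on page
    [p' - p + 1] at the latest. *)
Lemma perm_boundsE p q (x : page S 1 p q) : x \in @perm_bounds S p q <->
  exists v, [/\ v \in F p (p + q), v \in Bc (p + q) & x = fclass 1 p q v].
Proof.
split=> [/asboolP[r /survivesE[v [vZ xE /esym/eqP]]]|].
  rewrite sqclass_eq0// => /approx_boundsP[a [b [aZ bZ vE]]].
  have DbE : D b = v - a by rewrite vE [a + _]addrC addrK.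
  have [bF _] := approx_cyclesP _ _ _ _ _ _ bZ.
  have [vF _] := approx_cyclesP _ _ _ _ _ _ vZ.
  have [aF _] := approx_cyclesP _ _ _ _ _ _ aZ.
  exists (D b); split; last 1 first.
  - rewrite xE DbE fclass_prev//; first by apply: (approx_cyclesW F_le) vZ; lia.
    by apply: (approx_cyclesW F_le) aZ; lia.
  - by rewrite DbE rpredB//; apply: F_le aF; lia.
  - by apply/BcP; exists (p + r.+1%:Z - 1), b.
move=> [w [DbF /BcP[p' [b [bF wE]]] ->]]; subst w; apply/asboolP.
(* [b] lies in [F_(p + r)] for [r := `|p' - p| ]. *)
exists `|p' - p|%N; apply/survivesE.
exists (D b); have DbZ r : D b \in approx_cycles r p (p + q).
  by apply/approx_cyclesP; rewrite DbF DD rpred0.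
split=> //; apply/esym/eqP; rewrite sqclass_eq0; last exact: DbZ.
apply/approx_boundsP.
exists 0, b; rewrite rpred0 add0r; split=> //; apply/approx_cyclesP; split.
  by apply: F_le bF; lia.
rewrite addrK; apply: F_le DbF; lia.
Qed.

Definition homology_filt (n p : int) : {pred subquot (Zc n) (Bc n)} :=
  [pred h | `[< exists v, [/\ v \in F p n, D v = 0 & h = sqclass _ _ v] >]].
Arguments homology_filt : clear implicits.

Lemma filtered_cycle n p v : v \in F p n -> D v = 0 -> v \in Zc n.
Proof. by move=> vF Dv; apply/ZcP; exists p. Qed.

Lemma homology_filt_closed n p : zmod_closed (homology_filt n p).
Proof.
split=> [|u v].
  by apply/asboolP; exists 0; rewrite rpred0 raddf0 sqclass0.
move=> /asboolP[a [aF Da ->]] /asboolP[b [bF Db ->]]; apply/asboolP.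
exists (a - b); rewrite rpredB// raddfB Da Db subr0 sqclassB//;
  [exact: filtered_cycle aF Da|exact: filtered_cycle bF Db].
Qed.

HB.instance Definition _ n p := GRing.isZmodClosed.Build _
  (homology_filt n p) (homology_filt_closed n p).

Hypothesis Zc_bounded : forall n, exists p, forall v, v \in Zc n ->
  exists z, [/\ z \in F p n, D z = 0 & v - z \in Bc n].

(** Both the limit term and the graded piece of the homology are quotients of
    the cycles lying in [F_p], by the subgroup generated by the cycles of
    [F_(p-1)] and by the boundaries. *)
Lemma filtered_ss_converges : converges S (fun n => subquot (Zc n) (Bc n)).
Proof.
exists (fun n p => homology_filt n p : zmodClosed (subquot (Zc n) (Bc n))); split.
- move=> n p p' pp' h /asboolP[v [vF Dv ->]]; apply/asboolP; exists v.
  by split=> //; apply: F_le vF.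
- move=> n; have [b bP] := Zc_bounded n; exists (-1), b; split=> h.
    move=> /asboolP[v [vF _ ->]]; rewrite (F_neg _ vF)//.
    exact: sqclass0.
  have [v vZ ->] := sqclass_surj h; have [z [zF Dz vz]] := bP v vZ.
  apply/asboolP; exists z; split=> //; apply/sqclass_eq => //.
  exact: filtered_cycle zF Dz.
move=> p q; set n := p + q.
have h1 v : v \in F p n -> D v = 0 -> v \in approx_cycles 1 p n.
  by move=> vF Dv; apply/approx_cyclesP; rewrite Dv rpred0.
have h2 v : v \in F p n -> D v = 0 -> fclass 1 p q v \in @perm_cycles S p q.
  by move=> vF Dv; apply/perm_cyclesE; exists v.
have h3 v : v \in F p n -> D v = 0 ->
    (sqclass _ _ v : subquot (Zc n) (Bc n)) \in homology_filt n p.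
  by move=> vF Dv; apply/asboolP; exists v.
pose Rel (u : page_infty S p q)
    (w : subquot (homology_filt n p) (homology_filt n (p - 1))) :=
  exists v, [/\ v \in F p n, D v = 0, u = sqclass _ _ (fclass 1 p q v)
    & w = sqclass _ _ (sqclass _ _ v)].
have [|||||f [fbij _]] := @additive_relation_iso _ _ Rel; last by exists f.
- move=> _ _ _ _ [v [vF Dv -> ->]] [v' [vF' Dv' -> ->]]; exists (v - v').
  rewrite rpredB// raddfB Dv Dv' subr0; split=> //.
    rewrite -sqclassB//; [|exact: h2|exact: h2].
    by rewrite /fclass -sqclassB//; exact: h1.
  rewrite -sqclassB//; [|exact: h3|exact: h3].
  rewrite -sqclassB//; [exact: filtered_cycle vF Dv|exact: filtered_cycle vF' Dv'].
- move=> u; have [x xZ ->] := sqclass_surj u.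
  have [v [vF Dv ->]] := (perm_cyclesE x).1 xZ.
  by exists (sqclass _ _ (sqclass _ _ v)), v.
- move=> w; have [x xZ ->] := sqclass_surj w.
  have [v [vF Dv ->]] := asboolP _ xZ.
  by exists (sqclass _ _ (fclass 1 p q v)), v.
- move=> _ [v [vF Dv /esym/eqP + ->]].
  rewrite sqclass_eq0; last exact: h2.
  move=> /perm_boundsE[w [wF wB /sqclass_eq]].
  have [p' [b [_ wE]]] := (BcP _ _).1 wB.
  have Dw : D w = 0 by rewrite wE DD.
  rewrite -/n; move=> /(_ (h1 _ vF Dv) (h1 _ wF Dw)).
  move=> /approx_boundsP[a [c [/approx_cyclesP[aF _] /approx_cyclesP[cF _] vwE]]].
  apply/eqP; rewrite sqclass_eq0; last exact: h3.
  have aE : a = v - w - D c by rewrite vwE addrK.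
  have Da : D a = 0 by rewrite aE !raddfB Dv Dw DD !subr0.
  apply/asboolP; exists a; split=> //; apply/sqclass_eq.
  + exact: filtered_cycle vF Dv.
  + exact: filtered_cycle aF Da.
  + rewrite aE 2!opprD !opprK addrA addrA subrr add0r rpredD//.
    by apply/BcP; exists (p + 1 - 1), c.
- move=> _ [v [vF Dv -> /esym/eqP]].
  rewrite sqclass_eq0; last exact: h3.
  move=> /asboolP[a [aF Da /sqclass_eq]].
  move=> /(_ (filtered_cycle vF Dv) (filtered_cycle aF Da)) vaB.
  apply/eqP; rewrite sqclass_eq0; last exact: h2.
  have aF' : a \in F p n by apply: F_le aF; lia.
  apply/perm_boundsE; exists (v - a); rewrite rpredB//; split=> //.
  apply/esym/(fclass_prev F_le) => //; first exact: h1.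
  by apply/approx_cyclesP; rewrite Da rpred0.
Qed.

End FilteredConvergence.

(** * Additive maps on free abelian groups *)

Section FreeAbelian.
Variables (K : choiceType) (W : zmodType).
Implicit Types (f g : {additive {freeg K} -> W}) (z : {freeg K}).

Lemma additive_freegU f (k : int) (s : K) : f << k *g s >> = f << s >> *~ k.
Proof. by rewrite -raddfMz freegU_mulz intz. Qed.

Lemma additive_freegE f z : f z = \sum_(s <- dom z) f << s >> *~ coeff s z.
Proof.
rewrite -{1}(freeg_sumE z) raddf_sum; apply: eq_bigr => s _.
exact: additive_freegU.
Qed.

Lemma eq_additive_freeg f g z :
  (forall s, s \in dom z -> f << s >> = g << s >>) -> f z = g z.
Proof.
move=> fg; rewrite !additive_freegE; apply: eq_big_seq => s sz.
by rewrite fg.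
Qed.

Lemma additive_freeg0 f z :
  (forall s, s \in dom z -> f << s >> = 0) -> f z = 0.
Proof.
move=> f0; rewrite additive_freegE big1_seq// => s /andP[_ sz].
by rewrite f0// mul0rz.
Qed.

Lemma additive_freeg_in (P : zmodClosed W) f z :
  (forall s, s \in dom z -> f << s >> \in P) -> f z \in P.
Proof.
move=> fP; rewrite additive_freegE big_seq.
by apply: rpred_sum => s sz; rewrite rpredMz// fP.
Qed.

End FreeAbelian.

(** The extension of [f] is only used through its values on generators; taking
    it from an opaque existence proof keeps simplification from unfolding it. *)
Lemma fgext_subproof (K : choiceType) (M : lmodType int) (f : K -> M) :
  {h : {additive {freeg K} -> M} | forall s, h << s >> = f s}.
Proof.
by exists (additive_of (lift_is_additive f)) => s; rewrite /= liftU scale1r.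
Qed.

Definition fgext (K : choiceType) (M : lmodType int) (f : K -> M) :
  {additive {freeg K} -> M} := sval (fgext_subproof f).

Lemma fgextU (K : choiceType) (M : lmodType int) (f : K -> M) s :
  fgext f << s >> = f s.
Proof. exact: svalP (fgext_subproof f) s. Qed.

Lemma freegUZ (K : choiceType) (k : int) (s : K) :
  k *: << s >> = << k *g s >> :> {freeg K}.
Proof. by apply/eqP/freeg_eqP => t; rewrite coeffZ !coeffU mul1r. Qed.

Lemma additiveZ (K : choiceType) (W : lmodType int)
  (f : {additive {freeg K} -> W}) (k : int) z : f (k *: z) = k *: f z.
Proof. by rewrite -(intz k) !scaler_int raddfMz. Qed.

Lemma zmodClosedZ (W : lmodType int) (P : zmodClosed W) (k : int) (w : W) :
  w \in P -> k *: w \in P.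
Proof. by move=> wP; rewrite -(intz k) scaler_int rpredMz. Qed.

Lemma rem_cat_cons (T : eqType) (u : T) s t : u \notin s ->
  rem u (s ++ u :: t) = s ++ t.
Proof.
elim: s => [|x s IH] /=; first by rewrite eqxx.
by rewrite inE negb_or eq_sym => /andP[/negbTE -> /IH ->].
Qed.

(** * Faces of sequences and the boundary operator *)

Section Faces.
Variable K : choiceType.
Implicit Types (s t : seq K) (z : {freeg (seq K)}).

Definition faces s : {freeg (seq K)} :=
  \sum_(i < size s) (-1) ^+ i *: << take i s ++ drop i.+1 s >>.

Definition catl t := fgext (fun s : seq K => << t ++ s >> : {freeg (seq K)}).
Definition catr t := fgext (fun s : seq K => << s ++ t >> : {freeg (seq K)}).

Lemma faces_nil : faces [::] = 0. Proof. exact: big_ord0. Qed.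

Lemma faces_cons x s : faces (x :: s) = << s >> - catl [:: x] (faces s).
Proof.
rewrite /faces big_ord_recl /= expr0 scale1r drop0; congr (_ + _).
rewrite raddf_sum -sumrN; apply: eq_bigr => i _.
by rewrite additiveZ fgextU exprS mulN1r scaleNr.
Qed.

(** The Leibniz rule for concatenation. The computations with signs below rest
    on it. *)
Lemma faces_cat s t :
  faces (s ++ t) = catr t (faces s) + (-1) ^+ size s *: catl s (faces t).
Proof.
have catl0 z : catl [::] z = z.
  rewrite -[RHS]/(idfun z); apply: eq_additive_freeg => u _.
  by rewrite fgextU.
elim: s => [|x s IH] /=; first by rewrite faces_nil raddf0 add0r scale1r catl0.
rewrite !faces_cons IH raddfD raddfB fgextU opprD addrA; congr (_ - _ + _).
  rewrite -[LHS]/((catl [:: x] \o catr t) _) -[RHS]/((catr t \o catl [:: x]) _).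
  by apply: eq_additive_freeg => u _; rewrite /= !fgextU.
rewrite additiveZ exprS mulN1r scaleNr; congr (- (_ *: _)).
rewrite -[LHS]/((catl [:: x] \o catl s) _).
by apply: eq_additive_freeg => u _; rewrite /= !fgextU.
Qed.

Lemma mem_dom_faces s t : t \in dom (faces s) ->
  exists2 i, (i < size s)%N & t = take i s ++ drop i.+1 s.
Proof.
move=> /dom_sum_subset /flatten_mapP[i _] /domZ_subset.
by rewrite domU1 inE => /eqP ->; exists i.
Qed.

Lemma size_face i s : (i < size s)%N ->
  size (take i s ++ drop i.+1 s) = (size s).-1.
Proof. by move=> si; rewrite size_cat size_take size_drop si; lia. Qed.

Lemma size_dom_faces s t : t \in dom (faces s) -> size t = (size s).-1.
Proof. by move=> /mem_dom_faces[i si ->]; exact: size_face. Qed.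

Lemma face_subseq i s : subseq (take i s ++ drop i.+1 s) s.
Proof.
rewrite -{3}(cat_take_drop i s); apply: cat_subseq => //.
by rewrite -[i.+1]add1n -drop_drop; exact: drop_subseq.
Qed.

End Faces.

Section ChainComplex.
Context {d : Order.disp_t} {T : porderType d}.
Implicit Types (s t : seq T) (z : {freeg (seq T)}) (u : T) (A B : set T).

Lemma dom_faces s t : t \in dom (faces s) ->
  [/\ subseq t s, size t = (size s).-1 & (0 < size s)%N].
Proof.
move=> tf; have [i si tE] := mem_dom_faces tf.
split; [by rewrite tE face_subseq|exact: size_dom_faces|exact: leq_trans si].
Qed.

Lemma bdU aug s : bd aug << s >> = face_sum aug s.
Proof. by rewrite /bd liftU scale1r. Qed.

Lemma bdtU s : bd true << s >> = faces s.
Proof. exact: bdU. Qed.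

Lemma bdf_big z : (forall s, s \in dom z -> (1 < size s)%N) ->
  bd false z = bd true z.
Proof.
move=> sz; apply: eq_additive_freeg => s /sz s1.
by rewrite /= !bdU /face_sum s1.
Qed.

Lemma bdf_small z : (forall s, s \in dom z -> (size s <= 1)%N) -> bd false z = 0.
Proof.
move=> sz; apply: additive_freeg0 => s /sz s1.
by rewrite /= bdU /face_sum ltnNge s1.
Qed.

(** For the augmented complex this is the Leibniz rule. Without augmentation
    only the boundary of an edge needs a separate argument: its faces are points,
    whose boundary is zero. *)
Lemma bd_bd aug z : bd aug (bd aug z) = 0.
Proof.
have bdl (x : T) (w : {freeg (seq T)}) :
    bd true (catl [:: x] w) = w - catl [:: x] (bd true w).
  rewrite -[LHS]/((bd true \o catl [:: x]) w).
  rewrite -[RHS]/((idfun \- (catl [:: x] \o bd true)) w).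
  by apply: eq_additive_freeg => s _; rewrite /= fgextU !bdtU faces_cons.
have bdt (s : seq T) : bd true (faces s) = 0.
  elim: s => [|x s IH]; first by rewrite faces_nil raddf0.
  by rewrite faces_cons raddfB /= bdl bdtU IH raddf0 subr0 subrr.
rewrite -[LHS]/((bd aug \o bd aug) z).
apply: additive_freeg0 => s _; rewrite /= bdU /face_sum.
case: ifP => [|_]; last exact: raddf0.
case: aug => [_|/= s1]; first exact: bdt.
rewrite -/(faces s); have [s2|s2] := ltnP 2 (size s).
  by rewrite bdf_big ?bdt// => t /size_dom_faces ->; lia.
by rewrite bdf_small// => t /size_dom_faces ->; lia.
Qed.

Lemma chainsU aug A n s : is_chain aug A n s -> << s >> \in chains aug A n.
Proof. by move=> cs; rewrite inE domU1 /= cs. Qed.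

Lemma chainsP aug A n z :
  reflect (forall s, s \in dom z -> is_chain aug A n s) (z \in chains aug A n).
Proof. exact: allP. Qed.

Lemma is_chainP aug A n s : reflect
  [/\ sorted <%O s, (size s)%:Z = n + 1, forall x, x \in s -> A x
    & aug || (s != [::])] (is_chain aug A n s).
Proof.
apply: (iffP and4P) => -[? sz sA ?]; split=> //.
- exact/eqP.
- by move=> x xs; have := allP sA _ xs; rewrite inE.
- exact/eqP.
- by apply/allP => x /sA; rewrite inE.
Qed.

Lemma sub_chains aug A B n : A `<=` B ->
  {subset chains aug A n <= chains aug B n}.
Proof.
move=> AB z /chainsP zA; apply/chainsP => s /zA /is_chainP[? ? sA ?].
by apply/is_chainP; split=> // x /sA /AB.
Qed.

Lemma chains_bd aug A n z : z \in chains aug A n ->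
  bd aug z \in chains aug A (n - 1).
Proof.
move=> /chainsP zA; apply: additive_freeg_in => s /zA /is_chainP[so sz sA sn].
rewrite /= bdU /face_sum; case: ifP => [aug1|_]; last exact: rpred0.
rewrite -/(faces s); apply/chainsP => t tf.
have [ts tz s0] := dom_faces tf.
apply/is_chainP; split.
- exact: subseq_sorted lt_trans _ _ ts so.
- lia.
- by move=> x xt; apply: sA; exact: mem_subseq ts _ xt.
- by case: aug aug1 {zA sn} => //= s1; rewrite -size_eq0 tz -lt0n -ltnS prednK.
Qed.

(** * Removing and inserting a vertex *)

Definition link_at u : {additive {freeg (seq T)} -> {freeg (seq T)}} :=
  fgext (fun s => if u \in s then sgn s u *: << rem u s >> else 0).

(** The sign makes this inverse to [link_at u] on chains of the link of [u]. *)
Definition cone_at u : {additive {freeg (seq T)} -> {freeg (seq T)}} :=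
  fgext (fun s => let s1 := [seq x <- s | (x < u)%O] in
    (-1) ^+ size s1 *: << s1 ++ u :: [seq x <- s | (u < x)%O] >>).

Lemma link_at_notin u s : u \notin s -> link_at u << s >> = 0.
Proof. by rewrite fgextU => /negbTE ->. Qed.

Lemma link_at_split u s t : u \notin s ->
  link_at u << s ++ u :: t >> = (-1) ^+ size s *: << s ++ t >>.
Proof.
move=> us; rewrite fgextU mem_cat inE eqxx orbT /sgn.
by rewrite index_cat (negbTE us) /= eqxx addn0 rem_cat_cons.
Qed.

Lemma link_at_catr u t k z :
  (forall s, s \in dom z -> u \notin s /\ size s = k) ->
  link_at u (catr (u :: t) z) = (-1) ^+ k *: catr t z.
Proof.
move=> zP; rewrite -additiveZ -[LHS]/((link_at u \o catr (u :: t)) z).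
rewrite -[RHS]/((catr t \o GRing.scale ((-1) ^+ k)) z).
apply: eq_additive_freeg => s /zP[us sz] /=.
by rewrite additiveZ ![catr _ _]fgextU -sz link_at_split.
Qed.

Lemma link_at_catl u s z : u \notin s -> (forall t, t \in dom z -> u \notin t) ->
  link_at u (catl (rcons s u) z) = (-1) ^+ size s *: catl s z.
Proof.
move=> us zP; rewrite -additiveZ -[LHS]/((link_at u \o catl (rcons s u)) z).
rewrite -[RHS]/((catl s \o GRing.scale ((-1) ^+ size s)) z).
apply: eq_additive_freeg => t /zP ut /=.
by rewrite additiveZ ![catl _ _]fgextU cat_rcons link_at_split.
Qed.

Lemma catl_catl s t z : catl s (catl t z) = catl (s ++ t) z :> {freeg (seq T)}.
Proof.
rewrite -[LHS]/((catl s \o catl t) z).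
by apply: eq_additive_freeg => w _; rewrite /= !fgextU catA.
Qed.

Lemma notin_face u s t : u \notin s -> t \in dom (faces s) -> u \notin t.
Proof.
move=> us /mem_dom_faces[i _ ->]; apply: contra us.
exact: mem_subseq (face_subseq _ _) _.
Qed.

Lemma signMsign (n : nat) : (-1) ^+ n * (-1) ^+ n = 1 :> int.
Proof. by rewrite -expr2 sqrr_sign. Qed.

(** Removing [u] shifts by one the positions of the vertices after [u], and
    removing a vertex before [u] shifts the position of [u]; so the two operations
    anticommute. *)
Lemma link_at_bd u s : uniq s ->
  link_at u (bd true << s >>) = - bd true (link_at u << s >>).
Proof.
move=> us; have [uins|unins] := boolP (u \in s); last first.
  rewrite link_at_notin// raddf0 oppr0 bdtU.
  by apply: additive_freeg0 => t /(notin_face unins) /link_at_notin ->.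
case/splitPr: uins us => s1 s2.
rewrite cat_uniq /= negb_or => /and3P[us1 /andP[us1' _] /andP[us2 _]].
rewrite link_at_split// additiveZ !bdtU !faces_cat raddfD additiveZ faces_cons.
have -> : link_at u (catr (u :: s2) (faces s1)) =
    - ((-1) ^+ size s1 *: catr s2 (faces s1)).
  have [->|s1n] := eqVneq s1 [::].
    by rewrite faces_nil !raddf0 ?scaler0 ?oppr0.
  rewrite (link_at_catr _ (k := (size s1).-1)).
    rewrite -scaleNr; congr (_ *: _).
    by case: s1 s1n {us1 us1'} => // y s1 _; rewrite exprS mulN1r opprK.
  by move=> t tf; rewrite (notin_face us1' tf) (size_dom_faces tf).
rewrite raddfB catl_catl cats1 raddfB [catl s1 << _ >>]fgextU.
rewrite link_at_notin ?mem_cat ?negb_or ?us1' //.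
rewrite link_at_catl//; last by move=> t; exact: notin_face.
by rewrite sub0r scalerN /= bdtU faces_cat scalerDr opprD.
Qed.

Definition linked u (s : seq T) : Prop :=
  sorted <%O s /\ forall x, x \in s -> (x >=< u)%O /\ x != u.

(** A chain of points comparable with [u] does not come back below [u] once it
    has passed it. *)
Lemma linked_split u s : linked u s -> exists s1 s2,
  [/\ s = s1 ++ s2, all (fun x => (x < u)%O) s1, all (fun x => (u < x)%O) s2
    & sorted <%O (s1 ++ u :: s2)].
Proof.
move=> [so]; elim: s so => [|x s IH] /= so cmp; first by exists [::], [::].
have [xu xNu] := cmp x (mem_head _ _).
have [xu'|ux|xu'] := comparable_ltgtP xu.
- have [s1 [s2 [sE as1 as2 so12]]] := IH (path_sorted so)
    (fun y ys => cmp y (@mem_behead _ (x :: s) y ys)).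
  exists (x :: s1), s2; split=> //=; first by rewrite sE.
    by rewrite xu'.
  case: s1 sE as1 so12 => [|y s1] sE as1 so12 /=; first by rewrite xu'.
  by move: so; rewrite sE /= => /andP[-> _].
- exists [::], (x :: s); split=> //=; last by rewrite ux.
  rewrite ux /=; apply/allP => y ys; apply: (lt_trans ux).
  by have := order_path_min lt_trans so => /allP/(_ _ ys).
- by rewrite xu' eqxx in xNu.
Qed.

Lemma filter_none (P Q : pred T) s :
  (forall x, P x -> ~~ Q x) -> all P s -> [seq x <- s | Q x] = [::].
Proof.
move=> PQ /allP sP; apply/eqP; rewrite -(negbK (_ == _)) -has_filter.
by apply/hasPn => x /sP /PQ.
Qed.

Lemma cone_at_cat u s t : all (fun x => (x < u)%O) s ->
  all (fun x => (u < x)%O) t ->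
  cone_at u << s ++ t >> = (-1) ^+ size s *: << s ++ u :: t >>.
Proof.
move=> su ut; rewrite fgextU /= !filter_cat.
rewrite (all_filterP su) (all_filterP ut).
rewrite (filter_none _ ut) ?(filter_none _ su) ?cats0// => x xu;
  by rewrite lt_gtF.
Qed.

Lemma cone_at_catr u t k z : all (fun x => (u < x)%O) t ->
  (forall s, s \in dom z -> all (fun x => (x < u)%O) s /\ size s = k) ->
  cone_at u (catr t z) = (-1) ^+ k *: catr (u :: t) z.
Proof.
move=> ut zP; rewrite -additiveZ -[LHS]/((cone_at u \o catr t) z).
rewrite -[RHS]/((catr (u :: t) \o GRing.scale ((-1) ^+ k)) z).
apply: eq_additive_freeg => s /zP[us sz] /=.
by rewrite additiveZ ![catr _ _]fgextU -sz cone_at_cat.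
Qed.

Lemma cone_at_catl u s z : all (fun x => (x < u)%O) s ->
  (forall t, t \in dom z -> all (fun x => (u < x)%O) t) ->
  cone_at u (catl s z) = (-1) ^+ size s *: catl (rcons s u) z.
Proof.
move=> su zP; rewrite -additiveZ -[LHS]/((cone_at u \o catl s) z).
rewrite -[RHS]/((catl (rcons s u) \o GRing.scale ((-1) ^+ size s)) z).
apply: eq_additive_freeg => t /zP ut /=.
by rewrite additiveZ ![catl _ _]fgextU cat_rcons cone_at_cat.
Qed.

Lemma all_face (P : pred T) s t : all P s -> t \in dom (faces s) -> all P t.
Proof.
by move=> /allP sP /dom_faces[ts _ _]; apply/allP => x /(mem_subseq ts) /sP.
Qed.

(** The face opposite to the apex is [s] itself, with sign 1. *)
Lemma bd_cone_at u s : linked u s ->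
  bd true (cone_at u << s >>) = << s >> - cone_at u (bd true << s >>).
Proof.
move=> /linked_split[s1 [s2 [-> su us _]]].
rewrite cone_at_cat// additiveZ /= !bdtU !faces_cat faces_cons.
rewrite [in RHS]raddfD [in RHS]additiveZ cone_at_catl//; last first.
  by move=> t; exact: all_face.
have -> : cone_at u (catr s2 (faces s1)) =
    - ((-1) ^+ size s1 *: catr (u :: s2) (faces s1)).
  have [->|s1n] := eqVneq s1 [::].
    by rewrite faces_nil !raddf0 ?scaler0 ?oppr0.
  rewrite (cone_at_catr us (k := (size s1).-1)).
    rewrite -scaleNr; congr (_ *: _).
    by case: s1 s1n {su} => // y s1 _; rewrite exprS mulN1r opprK.
  by move=> t tf; rewrite (all_face su tf) (size_dom_faces tf).
rewrite raddfB catl_catl cats1 [catl s1 << _ >>]fgextU.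
rewrite scalerDr !scalerA signMsign !scale1r opprD opprK.
by rewrite addrCA.
Qed.

Lemma link_at_cone u s : linked u s -> link_at u (cone_at u << s >>) = << s >>.
Proof.
move=> us; have [s1 [s2 [sE su us2 _]]] := linked_split us; rewrite sE.
rewrite cone_at_cat// additiveZ link_at_split ?scalerA ?signMsign ?scale1r//.
by apply/negP => /(allP su); rewrite ltxx.
Qed.

Lemma link_at_cone_ne u v s : linked u s -> v != u -> v \notin s ->
  link_at v (cone_at u << s >>) = 0.
Proof.
move=> /linked_split[s1 [s2 [-> su us _]]] vu vs.
rewrite cone_at_cat// additiveZ link_at_notin ?scaler0//.
by move: vs; rewrite !mem_cat inE !negb_or vu => /andP[-> ->].
Qed.

Lemma sorted_around u s t : sorted <%O (s ++ u :: t) ->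
  all (fun x => (x < u)%O) s /\ all (fun x => (u < x)%O) t.
Proof.
rewrite lt_sorted_pairwise pairwise_cat /= => /and3P[+ _ /andP[ut _]].
by rewrite allrel_consr => /andP[su _].
Qed.

Lemma sorted_split u s : sorted <%O s -> u \in s -> exists s1 s2,
  [/\ s = s1 ++ u :: s2, rem u s = s1 ++ s2, u \notin s1,
      all (fun x => (x < u)%O) s1 & all (fun x => (u < x)%O) s2].
Proof.
move=> so us; have := lt_sorted_uniq so; case/splitPr: us so => s1 s2 so.
rewrite cat_uniq /= negb_or => /and3P[_ /andP[us1 _] _].
have [su ut] := sorted_around so.
by exists s1, s2; split=> //; exact: rem_cat_cons.
Qed.

Lemma sorted_comparable u v s : sorted <%O s -> u \in s -> v \in s ->
  (v >=< u)%O.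
Proof.
move=> so us; have [s1 [s2 [-> _ _ /allP su /allP ut]]] := sorted_split so us.
by rewrite mem_cat inE => /or3P[/su/ltW h|/eqP ->|/ut/ltW h]; apply/orP; auto.
Qed.

Lemma linked_rem u s : sorted <%O s -> u \in s -> linked u (rem u s).
Proof.
move=> so us; have ss := rem_subseq u s.
split; first exact: subseq_sorted lt_trans _ _ ss so.
move=> x; rewrite mem_rem_uniq ?lt_sorted_uniq// inE => /andP[xu xs]; split=> //.
exact: sorted_comparable xs.
Qed.

Lemma cone_at_link u s : sorted <%O s -> u \in s ->
  cone_at u (link_at u << s >>) = << s >>.
Proof.
move=> so us; have [s1 [s2 [-> _ us1 su ut]]] := sorted_split so us.
rewrite link_at_split// additiveZ cone_at_cat//.
by rewrite scalerA signMsign scale1r.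
Qed.

Lemma link_at_uniq u s : sorted <%O s -> u \in s ->
  link_at u << s >> = sgn s u *: << rem u s >>.
Proof. by move=> so us; rewrite fgextU us. Qed.

Lemma hatCP A u x : hatC A u x <-> [/\ A x, (x >=< u)%O & x != u].
Proof.
split=> [[[Ax xu] /eqP xNu]|[Ax xu /eqP xNu]]; first by split.
by split.
Qed.

Lemma is_chain_linked aug A n u s : is_chain aug (hatC A u) n s ->
  linked u s /\ forall x, x \in s -> A x.
Proof.
move=> /is_chainP[so _ sA _]; split.
  by split=> // x /sA /hatCP[].
by move=> x /sA /hatCP[].
Qed.

Lemma chains_link_at A n u z : z \in chains false A n ->
  link_at u z \in chains true (hatC A u) (n - 1).
Proof.
move=> /chainsP zA; apply: additive_freeg_in => s /zA /is_chainP[so sz sA sn].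
have [us|us] := boolP (u \in s); last by rewrite link_at_notin ?rpred0.
rewrite link_at_uniq//; apply/zmodClosedZ/chainsU/is_chainP.
have [so' lk] := linked_rem so us; split=> //.
  by rewrite size_rem// -subn1 -subzn ?sz ?addrK// -has_predT; apply/hasP; exists u.
move=> x xs; have [? ?] := lk x xs.
by apply/hatCP; split=> //; apply: sA; exact: mem_rem xs.
Qed.

Lemma chains_cone_at aug A n u z : A u -> z \in chains true (hatC A u) n ->
  cone_at u z \in chains aug A (n + 1).
Proof.
move=> Au /chainsP zA; apply: additive_freeg_in => s /zA sc.
have [lk sA] := is_chain_linked sc; have [_ sz _ _] := is_chainP _ _ _ _ sc.
have [s1 [s2 [sE su us so]]] := linked_split lk; rewrite sE cone_at_cat//.
apply/zmodClosedZ/chainsU/is_chainP; split=> //.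
- by rewrite -sz sE !size_cat /= addnS -addn1 PoszD.
- move=> x; rewrite mem_cat inE => xs.
  have [->//|xu] := eqVneq x u; apply: sA.
  by rewrite sE mem_cat; move: xs; rewrite (negbTE xu).
- by rewrite orbC; case: (s1).
Qed.

(** The two boundary operators only differ on points, where both sides
    vanish. *)
Lemma bd_link_at A n u z : z \in chains false A n ->
  link_at u (bd false z) = - bd true (link_at u z).
Proof.
move=> /chainsP zA; rewrite -[LHS]/((link_at u \o bd false) z) -raddfN.
rewrite -[RHS]/((bd true \o (-%R \o link_at u)) z).
apply: eq_additive_freeg => s /zA /is_chainP[so sz sA sn] /=.
rewrite raddfN; have [s1|s1] := leqP (size s) 1%N.
  rewrite bdf_small ?raddf0; last by move=> t; rewrite domU1 inE => /eqP ->.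
  case: s sn s1 {so sz sA} => [//|x [|//]] _ _.
  rewrite fgextU inE; case: eqP => [->|_]; last by rewrite raddf0 oppr0.
  by rewrite additiveZ /= bdtU eqxx faces_nil scaler0 oppr0.
rewrite bdf_big; first exact/link_at_bd/lt_sorted_uniq.
by move=> t; rewrite domU1 inE => /eqP ->.
Qed.

(** The condition on [n] excludes the empty chain, whose cone is a point and
    has no boundary in the complex without augmentation. *)
Lemma bd_cone_chain A n u z : 0 <= n -> z \in chains true (hatC A u) n ->
  bd false (cone_at u z) = z - cone_at u (bd true z).
Proof.
move=> n0 /chainsP zA; rewrite -[LHS]/((bd false \o cone_at u) z).
rewrite -[RHS]/((idfun \- (cone_at u \o bd true)) z).
apply: eq_additive_freeg => s /zA sc /=.
have [lk sA] := is_chain_linked sc; have [_ sz _ _] := is_chainP _ _ _ _ sc.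
rewrite -bd_cone_at// bdf_big// => t.
have [s1 [s2 [sE su us so]]] := linked_split lk; rewrite sE cone_at_cat//.
move=> /domZ_subset; rewrite domU1 inE => /eqP ->.
by move: sz; rewrite sE !size_cat /=; lia.
Qed.

End ChainComplex.

(** * Sheets of the covering poset *)

Section ChainMap.
Context {d d' : Order.disp_t} {T : porderType d} {T' : porderType d'}.
Variable f : T -> T'.

Definition chain_map : {additive {freeg (seq T)} -> {freeg (seq T')}} :=
  fgext (fun s => << map f s >>).

Lemma bd_chain_map z : bd true (chain_map z) = chain_map (bd true z).
Proof.
rewrite -[LHS]/((bd true \o chain_map) z) -[RHS]/((chain_map \o bd true) z).
apply: eq_additive_freeg => s _; rewrite /= fgextU !bdtU /faces size_map.
rewrite raddf_sum; apply: eq_bigr => i _.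
by rewrite additiveZ fgextU map_cat map_take map_drop.
Qed.

Lemma chain_map_chains aug A A' n n' z : n = n' -> z \in chains aug A n ->
  (forall s, is_chain aug A n s -> sorted <%O (map f s) /\
    forall x, x \in s -> A' (f x)) -> chain_map z \in chains aug A' n'.
Proof.
move=> <- /chainsP zA fA; apply: additive_freeg_in => s /zA sc.
have [so sA'] := fA s sc; rewrite fgextU; apply/chainsU/is_chainP.
have [_ sz _ sn] := is_chainP _ _ _ _ sc; split=> //.
- by rewrite size_map.
- by move=> _ /mapP[x xs ->]; exact: sA'.
- by case: (s) sn.
Qed.

End ChainMap.

Section CoverChains.
Context {d : Order.disp_t} {X : porderType d} {G : groupType}.
Variable c : coloring X G.
Implicit Types (u v : ecover c) (x y : X) (g h : G) (A B : set X).
Implicit Types (z : {freeg (seq X)}) (w : {freeg (seq (ecover c))}).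

Lemma ecover_leE u v :
  (u <= v)%O = (u.1 <= v.1)%O && (v.2 == u.2 * c u.1 v.1)%g.
Proof. by []. Qed.

Lemma ecover_ltE u v :
  (u < v)%O = (u.1 < v.1)%O && (v.2 == u.2 * c u.1 v.1)%g.
Proof.
rewrite -[LHS]/(ecover_lt u v) /ecover_lt /ecover_le lt_def.
case: u v => [x g] [y h] /=.
have [->|yx] := eqVneq y x; last first.
  by rewrite andbA; congr (_ && _ && _); apply/eqP => -[/eqP]; rewrite (negbTE yx).
rewrite lexx col_refl mulg1 andbT /= andbC; case: eqP => // ->.
by rewrite eqxx.
Qed.

Lemma colx_trans x y y' : (y >=< x)%O -> (y' >=< x)%O -> (y <= y')%O ->
  (colx c x y * c y y')%g = colx c x y'.
Proof.
move=> yx y'x yy'; rewrite /colx.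
have [xy|/negP xy] := boolP (x <= y)%O.
  by rewrite (le_trans xy yy') (col_trans c xy yy').
have {}yx : (y <= x)%O by case/orP: yx.
have [xy'|/negP xy'] := boolP (x <= y')%O.
  by rewrite (col_trans c yx xy') mulKg.
have {}y'x : (y' <= x)%O by case/orP: y'x.
rewrite (col_trans c yy' y'x); apply: (mulgI (c y y' * c y' x)%g).
by rewrite mulgA mulgV mul1g mulgK.
Qed.

(** The points comparable with [(x, g)] form a copy of those comparable with
    [x]: the group coordinate is forced. *)
Lemma ecover_comparable x g y h : (((y, h) : ecover c) >=< (x, g))%O <->
  (y >=< x)%O /\ h = (g * colx c x y)%g.
Proof.
rewrite /colx; split.
  case/orP; rewrite ecover_leE /= => /andP[yx /eqP ->].
    split; first by rewrite /Order.comparable yx.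
    have [xy|_] := boolP (x <= y)%O; last by rewrite mulgK.
    have -> : y = x by apply/eqP; rewrite eq_le yx xy.
    by rewrite !col_refl !mulg1.
  by rewrite yx; split=> //; rewrite /Order.comparable yx orbT.
move=> [yx ->]; apply/orP; rewrite !ecover_leE /=.
case: ifP => xy; first by right; rewrite eqxx.
by left; rewrite mulgVK eqxx andbT; move: yx; rewrite /Order.comparable xy orbF.
Qed.

(** The inverse bijections between the chains of the link of [x] and those of
    the link of [(x, g)], which identify the corresponding reduced homologies. *)
Definition to_sheet g x :=
  chain_map (fun y => (y, (g * colx c x y)%g) : ecover c).
Definition to_base := chain_map (fun u : ecover c => u.1).

Lemma to_sheetU g x s : to_sheet g x << s >> = << ecover_lift c g x s >>.
Proof. exact: fgextU. Qed.

Lemma to_sheetK g x z : to_base (to_sheet g x z) = z.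
Proof.
rewrite -[LHS]/((to_base \o to_sheet g x) z) -[RHS]/(idfun z).
apply: eq_additive_freeg => s _; rewrite /= !fgextU -map_comp.
by rewrite map_id_in.
Qed.

Lemma chains_to_sheet A n g x z : z \in chains true (hatC A x) n ->
  to_sheet g x z \in chains true (hatC (ecover_on c A) (x, g)) n.
Proof.
move=> zA; apply: (chain_map_chains erefl zA) => s sc.
have [[so lk] sA] := is_chain_linked sc; split.
  apply: (homo_sorted_in (P := mem s) _ _ so); last exact/allP.
  move=> y y' ys y's yy'.
  have [[yx _] [y'x _]] := (lk _ ys, lk _ y's).
  by rewrite ecover_ltE /= yy' -mulgA (colx_trans yx y'x (ltW yy')) eqxx.
move=> y ys; have [yx yNx] := lk _ ys; apply/hatCP; split.
- exact: sA ys.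
- exact/ecover_comparable.
- by apply: contra yNx => /eqP[->].
Qed.

Lemma chains_to_base A n g x w :
  w \in chains true (hatC (ecover_on c A) (x, g)) n ->
  to_base w \in chains true (hatC A x) n.
Proof.
move=> wA; apply: (chain_map_chains erefl wA) => s sc.
have [[so lk] sA] := is_chain_linked sc; split.
  apply: homo_sorted so => u v.
  by rewrite ecover_ltE => /andP[].
move=> [y h] ys; have [/ecover_comparable[yx hE] yNx] := lk _ ys.
apply/hatCP; split=> //=; first exact: sA _ ys.
apply: contra yNx => /eqP yE; rewrite hE yE /colx lexx col_refl mulg1.
exact: eqxx.
Qed.

Lemma to_baseK A n g x w :
  w \in chains true (hatC (ecover_on c A) (x, g)) n ->
  to_sheet g x (to_base w) = w.
Proof.
move=> /chainsP wA; rewrite -[LHS]/((to_sheet g x \o to_base) w) -[RHS]/(idfun w).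
apply: eq_additive_freeg => s /wA /is_chain_linked[[_ lk] _].
rewrite /= !fgextU -map_comp map_id_in// => -[y h] /lk.
by move=> [/ecover_comparable[_ ->] _].
Qed.

(** On chains over [X_p], for [x] in the layer [D_p], these two operations are
    what identifies [F_p / F_(p-1)] with a sum of complexes of links. *)
Definition link_coeff x g :
    {additive {freeg (seq (ecover c))} -> {freeg (seq X)}} :=
  to_base \o link_at ((x, g) : ecover c).

Definition sheet_cone x g :
    {additive {freeg (seq X)} -> {freeg (seq (ecover c))}} :=
  cone_at ((x, g) : ecover c) \o to_sheet g x.

Lemma link_coeff_chains A n x g w : w \in chains false (ecover_on c A) n ->
  link_coeff x g w \in chains true (hatC A x) (n - 1).
Proof. by move=> wA; apply: (@chains_to_base _ _ g); exact: chains_link_at. Qed.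

Lemma bd_link_coeff A n x g w : w \in chains false (ecover_on c A) n ->
  bd true (link_coeff x g w) = - link_coeff x g (bd false w).
Proof.
by move=> wA; rewrite /link_coeff /= bd_chain_map (bd_link_at _ wA) raddfN opprK.
Qed.

Lemma sheet_cone_chains A n x g z : A x -> z \in chains true (hatC A x) n ->
  sheet_cone x g z \in chains false (ecover_on c A) (n + 1).
Proof. by move=> Ax zA; apply: chains_cone_at => //; exact: chains_to_sheet. Qed.

Lemma link_coeff_cone A n x g z : z \in chains true (hatC A x) n ->
  link_coeff x g (sheet_cone x g z) = z.
Proof.
move=> /(chains_to_sheet g) /chainsP zA; rewrite -[RHS](to_sheetK g x).
rewrite /link_coeff /sheet_cone /=; congr (to_base _).
rewrite -[LHS]/((link_at _ \o cone_at _) _) -[RHS]/(idfun (to_sheet g x z)).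
apply: eq_additive_freeg => s /zA /is_chain_linked[lk _] /=.
exact: link_at_cone.
Qed.

Lemma link_coeff_cone_ne A n x g x' g' z : ((x >=< x')%O -> x = x') ->
  (x, g) != (x', g') -> z \in chains true (hatC A x') n ->
  link_coeff x g (sheet_cone x' g' z) = 0.
Proof.
move=> xx' xgNxg' /(chains_to_sheet g') /chainsP zA.
rewrite /link_coeff /sheet_cone /=.
rewrite -[to_base _]/((to_base \o (link_at ((x, g) : ecover c) \o
  cone_at ((x', g') : ecover c))) (to_sheet g' x' z)).
apply: additive_freeg0 => s /zA /is_chain_linked[lk _] /=.
rewrite link_at_cone_ne ?raddf0//; apply/negP => /(lk.2 _)[].
move=> /ecover_comparable[/xx' xE gE] _; move: xgNxg'; rewrite gE xE.
by rewrite /colx lexx col_refl mulg1 eqxx.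
Qed.

Lemma bd_sheet_cone A n x g z : 0 <= n -> z \in chains true (hatC A x) n ->
  bd true z = 0 -> bd false (sheet_cone x g z) = to_sheet g x z.
Proof.
move=> n0 zA dz; rewrite /sheet_cone /=.
rewrite (bd_cone_chain n0 (chains_to_sheet g zA)).
by rewrite bd_chain_map dz !raddf0 addr0.
Qed.

Lemma link_coeff_support x g w : link_coeff x g w != 0 ->
  exists2 s, s \in dom w & ((x, g) : ecover c) \in s.
Proof.
apply: contra_neqP => noS; apply: additive_freeg0 => s sw.
rewrite /link_coeff /= link_at_notin ?raddf0//.
by apply/negP => xgs; apply: noS; exists s.
Qed.

Lemma link_coeff_sub B n x g w : w \in chains false (ecover_on c B) n ->
  ~ B x -> link_coeff x g w = 0.
Proof.
move=> /chainsP wB Bx; apply/eqP/negP => /negP/link_coeff_support[s /wB].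
by move=> /is_chainP[_ _ sB _] /sB.
Qed.

(** Coning off the coefficient of [(x, g)] gives back the part of [w] carried
    by the chains through [(x, g)]; this part is therefore zero. *)
Lemma link_coeff_eq0 A B n w : w \in chains false (ecover_on c A) n ->
  (forall x g, A x -> ~ B x -> link_coeff x g w = 0) ->
  w \in chains false (ecover_on c B) n.
Proof.
move=> wA w0; apply/chainsP => s sw; have sc := chainsP _ _ _ _ wA s sw.
have [so sz sA sn] := is_chainP _ _ _ _ sc; apply/is_chainP; split=> //.
move=> [x g] xs; apply: contrapT => nBx.
have : cone_at ((x, g) : ecover c) (link_at ((x, g) : ecover c) w) = 0.
  rewrite -(to_baseK (chains_link_at _ wA)).
  by have /= -> := w0 x g (sA _ xs) nBx; rewrite !raddf0.
set u := (x, g) : ecover c.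
move=> /(congr1 (coeff s)); rewrite coeff0.
suff -> : coeff s (cone_at u (link_at u w)) = coeff s w.
  by move/eqP; rewrite -[_ == _]negbK -mem_dom sw.
rewrite -[LHS]/((coeff s \o (cone_at u \o link_at u)) w).
apply: eq_additive_freeg => t /(chainsP _ _ _ _ wA) /is_chainP[to _ _ _] /=.
have [ut|ut] := boolP (u \in t); first by rewrite cone_at_link.
rewrite link_at_notin// raddf0 coeff0 coeffU mul1r.
by case: eqP => // ts; rewrite ts xs in ut.
Qed.

End CoverChains.

(** * Cocycles on simply connected posets *)

Section LocallyConstant.
Context {R : realType}.

(** The supremum of the points up to which [P] holds throughout cannot be
    smaller than [b]. *)
Lemma locally_constant (a b : R) (P : R -> Prop) : a <= b ->
  (forall t, a <= t <= b -> exists2 e, 0 < e & forall t', a <= t' <= b ->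
     `|t' - t| < e -> (P t' <-> P t)) ->
  P a -> P b.
Proof.
move=> ab Ploc Pa.
pose S : set R := [set t | a <= t <= b /\ forall r, a <= r <= t -> P r].
have Sa : S a.
  split=> [|r ra]; first by rewrite lexx.
  by have -> : r = a by apply/eqP; rewrite eq_le andbC.
have Sub : ubound S b by move=> t [/andP[]].
have hS : has_sup S by split; [exists a|exists b].
have s_in : a <= sup S <= b.
  apply/andP; split; first by apply: sup_upper_bound.
  by apply: sup_le_ub => //; exists a.
have [e e0 sP] := Ploc _ s_in.
have [t [t_in St] st] := sup_adherent e0 hS.
have ts : t <= sup S by apply: sup_upper_bound.
have Ps : P (sup S).
  apply/(sP t t_in); last by apply: St; rewrite lexx andbT; lra.
  by rewrite ler0_norm; lra.
have Sext t' : a <= t' <= b -> t' < sup S + e -> S t'.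
  move=> t'_in t's; split=> // r r_in.
  have [rt|tr] := lerP r t; first by apply: St; lra.
  by apply/sP => //; [lra|rewrite ltr_norml; lra].
have [bs|sb] := lerP b (sup S + e / 2).
  have /Sext[] : a <= b <= b by rewrite ab lexx.
    lra.
  by move=> _; apply; rewrite ab lexx.
have Ss : S (sup S + e / 2) by apply: Sext; lra.
by have := sup_upper_bound hS Ss; lra.
Qed.

End LocallyConstant.

Section AlexandroffContinuity.
Context {R : realType} {d : Order.disp_t} {T : porderType d}.

Lemma nbhs_down (x : alexandroff T) : nbhs x [set y : T | (y <= x)%O].
Proof.
apply: open_nbhs_nbhs; split; last exact: lexx.
by move=> a b ab /= bx; exact: le_trans ab bx.
Qed.

Lemma nbhs_down_sub (x : alexandroff T) (U : set (alexandroff T)) :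
  nbhs x U -> [set y : T | (y <= x)%O] `<=` U.
Proof.
by rewrite nbhsE => -[V [oV Vx] VU] y yx; apply: VU; exact: oV yx Vx.
Qed.

(** The point [u x] has a smallest neighbourhood, the set of points below
    it. *)
Lemma alexandroff_continuous (M : pseudoMetricType R) (A : set M)
    (u : M -> alexandroff T) :
  {within A, continuous u} <-> forall x, A x ->
    exists2 e, 0 < e & forall y, A y -> ball x e y -> (u y <= u x :> T)%O.
Proof.
rewrite subspace_continuousP; split=> uc x Ax.
  have /nbhs_ballP[e e0 eP] := uc x Ax _ (nbhs_down (u x)).
  by exists e => // y Ay xy; exact: eP xy Ay.
have [e e0 eP] := uc x Ax; move=> U /nbhs_down_sub xU.
by apply/nbhs_ballP; exists e => // y xy Ay; apply/xU/eP.
Qed.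

(** A primitive of the additive cocycle [f] along the path [u]: the values of
    [L] near [r] are dictated by [f], because [u] stays below [u r] there. *)
Definition primitive (A : zmodType) (f : T -> T -> A) (u : R -> T) (b : R)
    (L : R -> A) : Prop :=
  forall r, 0 <= r <= b -> exists2 e, 0 < e & forall r', 0 <= r' <= b ->
    `|r' - r| < e -> (u r' <= u r)%O /\ L r - L r' = f (u r') (u r).

Lemma unit_itvP (t : R) : (`[0, 1]%classic : set R) t <-> 0 <= t <= 1.
Proof. by rewrite /= in_itv. Qed.

Lemma path_continuousP (u : R -> alexandroff T) :
  {within `[0, 1], continuous u} <-> forall r, 0 <= r <= 1 ->
    exists2 e, 0 < e & forall r', 0 <= r' <= 1 -> `|r' - r| < e ->
      (u r' <= u r :> T)%O.
Proof.
rewrite alexandroff_continuous; split=> uc r.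
  move=> /unit_itvP /uc[e e0 eP]; exists e => // r' /unit_itvP r'1 rr'.
  by apply: eP => //; rewrite -ball_normE /= distrC.
move=> /unit_itvP /uc[e e0 eP]; exists e => // r' /unit_itvP r'1 rr'.
by apply: eP => //; move: rr'; rewrite -ball_normE /= distrC.
Qed.

Lemma homotopy_continuousP (h : R * R -> alexandroff T) :
  {within `[0, 1] `*` `[0, 1], continuous h} -> forall t s,
    0 <= t <= 1 -> 0 <= s <= 1 ->
    exists2 e, 0 < e & forall t' s', 0 <= t' <= 1 -> 0 <= s' <= 1 ->
      `|t' - t| < e -> `|s' - s| < e -> (h (t', s') <= h (t, s) :> T)%O.
Proof.
move=> /alexandroff_continuous hc t s /unit_itvP t1 /unit_itvP s1.
have [e e0 eP] := hc (t, s) (conj t1 s1).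
exists e => // t' s' /unit_itvP t'1 /unit_itvP s'1 tt' ss'.
by apply: eP => //; split; rewrite -ball_normE /= distrC.
Qed.

Section Cocycle.
Variables (A : zmodType) (f : T -> T -> A).
Hypothesis fD : forall x y z, (x <= y)%O -> (y <= z)%O -> f x z = f x y + f y z.

Lemma cocycle_refl x : f x x = 0.
Proof.
by have := fD (lexx x) (lexx x); rewrite -[LHS]addr0 => /addrI <-.
Qed.

(** A primitive extends across any interval on which [u] stays below one of
    its values [u t]: there [r |-> - f (u r) (u t)] is a primitive, up to a
    constant. So the existence of a primitive on [[0, t]] is a locally constant
    property of [t]. *)
Lemma primitive_exists (u : R -> alexandroff T) :
  {within `[0, 1], continuous u} -> exists L, primitive f u 1 L.
Proof.
move=> /path_continuousP uc.
pose P t := exists L, primitive f u t L.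
suff : P 1 by [].
apply: (locally_constant (a := 0) ler01); last first.
  exists (fun=> 0) => r r_in; exists 1 => // r' r'_in _.
  have -> : r' = r by lra.
  by rewrite lexx subrr cocycle_refl.
move=> t t_in; have [e e0 ut] := uc t t_in; exists e => //.
suff ext t0 t1 : 0 <= t0 <= 1 -> 0 <= t1 <= 1 ->
    `|t0 - t| < e -> `|t1 - t| < e -> P t0 -> P t1.
  move=> t' t'_in t't; have tt : `|t - t| < e by rewrite subrr normr0.
  by split; apply: ext.
move=> t0_in t1_in t0t t1t [L LP].
have [t10|t01] := lerP t1 t0.
  exists L => r r_in; have [|e' e'0 e'P] := LP r; first lra.
  by exists e' => // r' r'_in; apply: e'P; lra.
pose L' r := if r <= t0 then L r else L t0 + f (u t0) (u t) - f (u r) (u t).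
have L'E r : t0 <= r -> L' r = L t0 + f (u t0) (u t) - f (u r) (u t).
  rewrite /L'; case: ifP => // rt0 t0r.
  have -> : r = t0 by apply/eqP; rewrite eq_le rt0.
  by rewrite addrK.
exists L' => r r_in.
have r_le1 : 0 <= r <= 1 by lra.
have [e1 e10 u1] := uc r r_le1.
have right r' : t0 <= r -> t0 <= r' <= t1 -> `|r' - r| < e1 ->
    (u r' <= u r)%O /\ L' r - L' r' = f (u r') (u r).
  move=> t0r r'_in r'r; have r'_le1 : 0 <= r' <= 1 by lra.
  have ur'r := u1 r' r'_le1 r'r; split=> //.
  rewrite !L'E//; last by lra.
  have urt : (u r <= u t)%O.
    by apply: ut => //; move: t0t t1t; rewrite !ltr_norml; lra.
  by rewrite (fD ur'r urt) opprB addrC addrA subrK addrK.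
have [rt0|t0r] := ltrP r t0.
  have [|e2 e20 L2] := LP r; first lra.
  exists (Num.min e2 (t0 - r)); first by rewrite lt_min e20; lra.
  move=> r' r'_in; rewrite lt_min ltr_norml => /andP[/andP[r'1 r'2] r'3].
  have r't0 : r' <= t0 by move: r'3; rewrite ltr_norml; lra.
  by rewrite /L' r't0 (ltW rt0); apply: L2; [lra|rewrite ltr_norml r'1].
have [rE|rt0] := eqVneq r t0.
  have [|e2 e20 L2] := LP r; first lra.
  exists (Num.min e1 e2); first by rewrite lt_min e10.
  move=> r' r'_in; rewrite lt_min => /andP[r'1 r'2].
  have [r't0|t0r'] := lerP r' t0; last by apply: right => //; lra.
  by rewrite /L' r't0 rE lexx -rE; apply: L2 => //; lra.
exists (Num.min e1 (r - t0)); first by rewrite lt_min e10; move: rt0; lra.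
move=> r' r'_in; rewrite lt_min => /andP[r'1 r'2].
by apply: right => //; move: r'2; rewrite ltr_norml; lra.
Qed.

Lemma subr_exchange (W : zmodType) (a b a' b' : W) :
  a - b = a' - b' -> a - a' = b - b'.
Proof.
move=> /eqP; rewrite subr_eq => /eqP ->.
by rewrite addrAC [a' - b']addrC addrK addrC.
Qed.

(** The difference of two primitives is locally constant. *)
Lemma primitive_unique (u : R -> T) L L' :
  primitive f u 1 L -> primitive f u 1 L' -> L 1 - L 0 = L' 1 - L' 0.
Proof.
move=> LP LP'; pose P r := L r - L' r = L 0 - L' 0.
suff : P 1 by exact: subr_exchange.
apply: (locally_constant (a := 0) ler01) => // t t_in.
have [[e e0 eP] [e' e'0 eP']] := (LP t t_in, LP' t t_in).
exists (Num.min e e'); first by rewrite lt_min e0.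
move=> t' t'_in; rewrite lt_min => /andP[/(eP _ t'_in)[_ Lt] /(eP' _ t'_in)[_ Lt']].
rewrite /P (@subr_exchange _ (L t') (L t) (L' t') (L' t))//.
by rewrite -opprB Lt -Lt' opprB.
Qed.

Lemma primitive_below (u : R -> T) (x : T) L t t' : primitive f u 1 L ->
  0 <= t <= 1 -> 0 <= t' <= 1 ->
  (forall r, t <= r <= t' \/ t' <= r <= t -> (u r <= x)%O) ->
  L t' - L t = f (u t) x - f (u t') x.
Proof.
move=> LP; wlog tt' : t t' / t <= t'.
  move=> H t_in t'_in ux; have [tt'|t't] := lerP t t'; first exact: H.
  rewrite -[LHS]opprB -[RHS]opprB (H t' t) ?opprB//; first exact: ltW.
  by move=> r r_in; apply: ux; tauto.
move=> t_in t'_in ux; pose P r := L r + f (u r) x = L t + f (u t) x.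
suff : P t'.
  rewrite /P => PE; rewrite (@subr_exchange _ _ (- f (u t') x) _ (- f (u t) x)).
    by rewrite opprK addrC.
  by rewrite !opprK.
apply: (locally_constant tt') => // r r_in.
have r_in1 : 0 <= r <= 1 by lra.
have [e e0 eP] := LP r r_in1; exists e => // r' r'_in r'r.
have [|ur'r Lr] := eP r' _ r'r; first lra.
suff : L r' + f (u r') x = L r + f (u r) x by rewrite /P => ->.
have urx : (u r <= x)%O by apply: ux; left.
by rewrite (fD ur'r urx) -Lr addrA subrKC.
Qed.

Lemma increments_cancel (W : zmodType) (a0 a1 a2 b0 b1 b2 p1 p2 k1 k2 : W) :
  a2 - a1 = p1 - p2 -> b2 - b1 = k1 + p1 - (k2 + p2) ->
  a1 - a0 - (b1 - b0) = k1 -> a2 - a0 - (b2 - b0) = k2.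
Proof.
have E (x y z : W) : x - z = (x - y) + (y - z) by rewrite addrA subrK.
rewrite (E a2 a1 a0) (E b2 b1 b0) => -> -> k1E.
rewrite [in LHS]opprD addrACA k1E.
have -> : k1 + p1 - (k2 + p2) = k1 - k2 + (p1 - p2) by rewrite opprD addrACA.
by rewrite opprD addrCA subrr addr0 opprB subrK.
Qed.

(** The increment along the rows of a homotopy is locally constant. Near the
    row [s0], the increments along row [s] and row [s0] up to time [t] differ by
    [f (h (t, s)) (h (t, s0))]: this holds at [t = 0], is locally constant in
    [t], and gives the equality of the increments at [t = 1] because all rows have
    the same end. *)
Lemma homotopy_primitive (u v : R -> alexandroff T) Lu Lv :
  path_homotopic u v -> primitive f u 1 Lu -> primitive f v 1 Lv ->
  Lu 1 - Lu 0 = Lv 1 - Lv 0.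
Proof.
move=> [h [/homotopy_continuousP hc hbot hside]] LuP LvP.
have itv0 : 0 <= (0 : R) <= 1 by rewrite lexx ler01.
have itv1 : 0 <= (1 : R) <= 1 by rewrite lexx ler01.
have itvE t : 0 <= t <= 1 -> t \in `[(0 : R), 1] by rewrite in_itv.
have hrow s : 0 <= s <= 1 ->
    {L | primitive f (fun t => h (t, s) : T) 1 L}.
  move=> s_in; apply/cid/primitive_exists/path_continuousP => t t_in.
  have [e e0 eP] := hc t s t_in s_in; exists e => // t' t'_in tt'.
  by apply: eP => //; rewrite subrr normr0.
have {}hrow s : {L | 0 <= s <= 1 -> primitive f (fun t => h (t, s) : T) 1 L}.
  have [s_in|s_out] := boolP (0 <= s <= 1); last by exists (fun=> 0).
  by have [L LP] := hrow s s_in; exists L.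
pose L s := sval (hrow s).
have LP s : 0 <= s <= 1 -> primitive f (fun t => h (t, s) : T) 1 (L s).
  by rewrite /L; case: (hrow s).
pose I s := L s 1 - L s 0.
have Iu : Lu 1 - Lu 0 = I 0.
  apply: primitive_unique (LP 0 itv0) => r r_in.
  have [e e0 eP] := LuP r r_in; exists e => // r' r'_in r'r.
  by rewrite (hbot r' (itvE _ r'_in)).1 (hbot r (itvE _ r_in)).1; exact: eP.
have Iv : Lv 1 - Lv 0 = I 1.
  apply: primitive_unique (LP 1 itv1) => r r_in.
  have [e e0 eP] := LvP r r_in; exists e => // r' r'_in r'r.
  by rewrite (hbot r' (itvE _ r'_in)).2 (hbot r (itvE _ r_in)).2; exact: eP.
rewrite Iu Iv; apply/esym; pose P s := I s = I 0; suff : P 1 by [].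
apply: (locally_constant (a := 0) ler01) => // s0 s0_in.
suff [e e0 eP] : exists2 e, 0 < e & forall s, 0 <= s <= 1 -> `|s - s0| < e ->
    I s0 = I s.
  by exists e => // s s_in ss; rewrite /P (eP s).
pose Q t := exists2 e, 0 < e & forall s, 0 <= s <= 1 -> `|s - s0| < e ->
  (h (t, s) <= h (t, s0) :> T)%O /\
  (L s0 t - L s0 0) - (L s t - L s 0) = f (h (t, s)) (h (t, s0)).
suff [e e0 eP] : Q 1.
  exists e => // s s_in ss; have [_ /eqP] := eP s s_in ss.
  rewrite (hside s (itvE _ s_in)).2 (hside s0 (itvE _ s0_in)).2 cocycle_refl.
  by rewrite subr_eq0 => /eqP.
apply: (locally_constant (a := 0) ler01); last first.
  exists 1 => // s s_in _.
  rewrite (hside s (itvE _ s_in)).1 (hside s0 (itvE _ s0_in)).1 cocycle_refl.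
  by rewrite lexx !subrr.
move=> t t_in; have [e e0 ht] := hc t s0 t_in s0_in; exists e => //.
suff ext t1 t2 : 0 <= t1 <= 1 -> 0 <= t2 <= 1 ->
    `|t1 - t| < e -> `|t2 - t| < e -> Q t1 -> Q t2.
  move=> t' t'_in t't; have tt : `|t - t| < e by rewrite subrr normr0.
  by split; apply: ext.
move=> t1_in t2_in t1t t2t [e1 e10 Q1].
have [e2 e20 h2] := hc t2 s0 t2_in s0_in.
exists (Num.min e (Num.min e1 e2)); first by rewrite !lt_min e0 e10.
move=> s s_in; rewrite !lt_min => /and3P[se se1 se2].
have [h1s L1] := Q1 s s_in se1.
have h2s : (h (t2, s) <= h (t2, s0) :> T)%O.
  by apply: h2 => //; rewrite subrr normr0.
split=> //; set x : T := h (t, s0).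
have between s' : 0 <= s' <= 1 -> `|s' - s0| < e ->
    L s' t2 - L s' t1 = f (h (t1, s')) x - f (h (t2, s')) x.
  move=> s'_in s's; apply: (primitive_below (LP s' s'_in)) => // r r_in.
  apply: ht => //; first lra.
  by move: t1t t2t; rewrite !ltr_norml; lra.
have hx t' : 0 <= t' <= 1 -> `|t' - t| < e -> (h (t', s0) <= x :> T)%O.
  by move=> t'_in t't; apply: ht => //; rewrite subrr normr0.
have b0 := between s0 s0_in; rewrite subrr normr0 in b0.
have {}b0 := b0 e0; have bs := between s s_in se.
rewrite (fD h1s (hx t1 t1_in t1t)) (fD h2s (hx t2 t2_in t2t)) in bs.
exact: increments_cancel b0 bs L1.
Qed.

(** Integrating [f] along paths from a base point gives a potential: going to
    [a], stepping up to [b] and coming back along the path of [b] is a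
    null-homotopic loop. *)
Lemma simply_connected_potential (e0 : T) : simply_connected R (alexandroff T) ->
  exists g : T -> A, forall a b, (a <= b)%O -> f a b = g b - g a.
Proof.
move=> [pathT loopT].
have pathL (y : alexandroff T) : {uL : (R -> alexandroff T) * (R -> A) |
    is_path (e0 : alexandroff T) y uL.1 /\ primitive f uL.1 1 uL.2}.
  apply: cid; have [u up] := pathT e0 y.
  have [L LP] : exists L, primitive f u 1 L.
    by apply: primitive_exists; case: up.
  by exists (u, L).
pose u y := (sval (pathL y)).1; pose L y := (sval (pathL y)).2.
have uP y : is_path (e0 : alexandroff T) y (u y) by exact: (svalP (pathL y)).1.
have LP y : primitive f (u y) 1 (L y) by exact: (svalP (pathL y)).2.
exists (fun y => L y 1 - L y 0) => a b ab.
have [_ ua0 ua1] := uP a; have [_ ub0 ub1] := uP b.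
(* The value at 1/2 is [b], above [a]: this is what makes [w] continuous there. *)
pose w t := if t < 2^-1 then u a (2 * t) else u b (2 - 2 * t).
(* [K] makes the two halves agree, across the step from [a] to [b], at 1/2. *)
pose K := L a 1 + f a b - L b 1.
pose M t := if t < 2^-1 then L a (2 * t) else L b (2 - 2 * t) + K.
have ltF (t : R) : 2^-1 <= t -> (t < 2^-1) = false by rewrite ltNge => ->.
have wM : primitive f w 1 M.
  move=> t t_in; have [t2|t2|t2] := ltrgtP t 2^-1.
  - have [|e e00 eP] := LP a (2 * t); first lra.
    exists (Num.min (e / 2) (2^-1 - t)); first by rewrite lt_min; lra.
    move=> t' t'_in; rewrite lt_min !ltr_norml => /andP[t'1 t'3].
    rewrite /w /M t2 (_ : t' < 2^-1); last lra.
    by apply: eP; rewrite ?ltr_norml; lra.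
  - have [|e e00 eP] := LP b (2 - 2 * t); first lra.
    exists (Num.min (e / 2) (t - 2^-1)); first by rewrite lt_min; lra.
    move=> t' t'_in; rewrite lt_min !ltr_norml => /andP[t'1 t'3].
    rewrite /w /M (ltF t (ltW t2)) (ltF t'); last lra.
    by rewrite opprD addrACA subrr addr0; apply: eP; rewrite ?ltr_norml; lra.
  - have [|e e00 eP] := LP b (2 - 2 * t); first lra.
    have [|e' e'00 eP'] := LP a (2 * t); first lra.
    exists (Num.min (e / 2) (e' / 2)); first by rewrite lt_min; lra.
    move=> t' t'_in; rewrite lt_min !ltr_norml => /andP[t'1 t'3].
    have E1 : 2 * t = 1 by lra.
    have E2 : 2 - 2 * t = 1 by lra.
    rewrite /w /M (ltF t); last lra.
    have [t't|t't] := ltrP t' 2^-1.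
      have [||u't' Lt'] := eP' (2 * t'); [lra|rewrite ltr_norml; lra|].
      rewrite E1 ua1 in u't' Lt'; rewrite E2 ub1; split; first exact: le_trans ab.
      by rewrite /K (fD u't' ab) -Lt' [L b 1 + _]addrC subrK [RHS]addrAC.
    by rewrite opprD addrACA subrr addr0; apply: eP; rewrite ?ltr_norml; lra.
have wp : is_path (e0 : alexandroff T) e0 w.
  split.
  - apply/path_continuousP => t t_in; have [e e00 eP] := wM t t_in.
    by exists e => // t' t'_in /(eP t' t'_in)[].
  - by rewrite /w ifT ?mulr0//; lra.
  - rewrite /w ltF; last lra.
    by rewrite mulr1 subrr.
have cP : primitive f (cst (e0 : alexandroff T)) 1 (fun=> 0).
  move=> r _; exists 1 => // r' _ _; rewrite /cst /= lexx subrr.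
  by rewrite cocycle_refl.
have := homotopy_primitive (loopT _ _ wp) wM cP.
rewrite subrr /M ltF; last lra.
rewrite ifT; last lra.
rewrite mulr1 mulr0 subrr /K => /eqP; rewrite subr_eq0 => /eqP <-.
rewrite opprB !addrA subrK -[_ - L b 1 - L a 1]addrA -opprD.
by rewrite [_ + f a b - _]addrAC subrr add0r.
Qed.

End Cocycle.

(** Near [t] the path stays below [u t], so that the truth of [P (u t)] is
    locally constant. *)
Lemma path_invariant (P : T -> Prop) (x y : alexandroff T) (u : R -> _) :
  is_path x y u -> (forall a b, (a <= b)%O -> P a <-> P b) -> P x -> P y.
Proof.
move=> [/path_continuousP uc <- <-] Pcmp.
apply: (locally_constant (P := fun t => P (u t)) ler01) => t t_in.
have [e e0 eP] := uc t t_in; exists e => // t' t'_in t't.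
exact: (Pcmp _ _ (eP t' t'_in t't)).
Qed.

End AlexandroffContinuity.

(** * Degrees 0 and 1 of a simply connected poset *)

Section LowHomology.
Context {R : realType} {d : Order.disp_t} {T : porderType d}.
Hypothesis T_sc : simply_connected R (alexandroff T).

Lemma faces1 (x : T) : faces [:: x] = << [::] >>.
Proof. by rewrite faces_cons faces_nil raddf0 subr0. Qed.

Lemma faces2 (x y : T) : faces [:: x; y] = << [:: y] >> - << [:: x] >>.
Proof. by rewrite faces_cons faces1 fgextU. Qed.

Lemma boundary_edge (x y : T) : (x < y)%O ->
  << [:: y] >> - << [:: x] >> \in boundaries false [set: T] 0.
Proof.
move=> xy; apply/asboolP; exists << [:: x; y] >>.
  by apply/chainsU/is_chainP; split=> //=; rewrite ?xy.
by rewrite bdU /face_sum /= -/(faces [:: x; y]) faces2.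
Qed.

(** Being homologous to [x] is not affected by passing to a comparable point,
    hence constant along paths. *)
Lemma point_homologous (x y : T) :
  << [:: y] >> - << [:: x] >> \in boundaries false [set: T] 0.
Proof.
have [u up] := T_sc.1 x y.
pose P z : Prop := << [:: z] >> - << [:: x] >> \in boundaries false [set: T] 0.
suff : P y by [].
apply: (path_invariant (P := P) up) => [a b|]; last by rewrite /P subrr rpred0.
rewrite le_eqVlt => /predU1P[->//|/boundary_edge ab]; rewrite /P.
have -> : << [:: b] >> - << [:: x] >> =
    (<< [:: b] >> - << [:: a] >>) + (<< [:: a] >> - << [:: x] >>) :> {freeg (seq T)}.
  by rewrite addrA subrK.
by rewrite [X in _ <-> is_true X](rpredDl _ ab); split.
Qed.

Lemma cycles0_point (x : T) z : z \in chains false [set: T] 0 ->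
  exists k : int, z - << k *g [:: x] >> \in boundaries false [set: T] 0.
Proof.
move=> /chainsP zC; exists (\sum_(s <- dom z) coeff s z).
have -> : << \sum_(s <- dom z) coeff s z *g [:: x] >> =
    fgext (fun=> << [:: x] >> : {freeg (seq T)}) z.
  rewrite additive_freegE -freegUZ scaler_suml; apply: eq_bigr => s _.
  by rewrite fgextU -{1}[coeff s z]intz scaler_int.
apply: (additive_freeg_in (f := idfun \- fgext (fun=> << [:: x] >>))) => s /zC.
move=> /is_chainP[_ sz _ _]; rewrite /= fgextU.
case: s sz => [//|y [|//]] _; exact: point_homologous.
Qed.

Lemma boundary_triangle (x y z : T) : (x < y)%O -> (y < z)%O ->
  << [:: y; z] >> - << [:: x; z] >> + << [:: x; y] >>
    \in boundaries false [set: T] 1.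
Proof.
move=> xy yz; apply/asboolP; exists << [:: x; y; z] >>.
  by apply/chainsU/is_chainP; split=> //=; rewrite ?xy ?yz.
rewrite bdU /face_sum /= -/(faces [:: x; y; z]) faces_cons faces2.
by rewrite raddfB !fgextU opprB addrA addrAC.
Qed.

(** The map sending an edge to its class modulo boundaries is a cocycle, hence
    has a potential; so the class of a chain only depends on its boundary. *)
Lemma cycles1_boundary z : z \in cycles false [set: T] 1 ->
  z \in boundaries false [set: T] 1.
Proof.
move=> /andP[zC /eqP dz].
pose B : zmodClosed {freeg (seq T)} := boundaries false [set: T] 1.
(* [zmodule] makes the quotient a module over the integers, as [fgext] requires. *)
pose A : zmodType := Quotient.quot B.
pose cl (w : {freeg (seq T)}) : zmodule A := \pi_(Quotient.quot B)%qT w.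
have cl_additive : additive cl.
  by move=> v w; rewrite /cl pi_addr pi_oppr.
pose cla := additive_of cl_additive.
have cl_eq0 w : cl w = 0 <-> w \in B.
  have -> : 0 = cl 0 by exact/esym/(raddf0 cla).
  by rewrite /cl; split=> [/eqP|wB]; [|apply/eqP]; rewrite -Quotient.idealrBE subr0.
pose f x y : zmodule A := if (x < y)%O then cl << [:: x; y] >> else 0.
have fD x y w : (x <= y)%O -> (y <= w)%O -> f x w = f x y + f y w.
  rewrite /f le_eqVlt => /predU1P[->|xy]; first by rewrite ltxx add0r.
  rewrite le_eqVlt => /predU1P[<-|yw]; first by rewrite ltxx addr0 xy.
  rewrite xy yw (lt_trans xy yw).
  apply/eqP; rewrite addrC eq_sym -subr_eq0 -[cl]/(cla : _ -> _).
  rewrite -raddfD -raddfB; apply/eqP/cl_eq0.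
  by rewrite addrAC boundary_triangle.
have [[x0 _]|/forallNP noT] := pselect (exists x : T, True); last first.
  rewrite (_ : z = 0) ?rpred0//.
  apply/eqP; rewrite -dom_eq0; apply/eqP.
  case E : (dom z) => [//|s l]; have := chainsP _ _ _ _ zC s.
  rewrite E mem_head => /(_ isT) /is_chainP[_].
  by case: s {E} => // x; case: (noT x).
have [g gP] := simply_connected_potential fD x0 T_sc.
pose h : {additive {freeg (seq T)} -> zmodule A} :=
  fgext (fun s => if s is [:: x] then g x else 0).
apply/cl_eq0; rewrite -(raddf0 h) -dz.
rewrite -[LHS]/(cla z) -[RHS]/((h \o bd false) z).
apply: eq_additive_freeg => s /(chainsP _ _ _ _ zC) /is_chainP[so sz _ _] /=.
case: s so sz => [//|x [//|y [|//]]] /=; rewrite andbT => xy _.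
rewrite bdU /face_sum /= -/(faces [:: x; y]) faces2 raddfB !fgextU.
by rewrite -gP ?ltW// /f xy.
Qed.

End LowHomology.

(** * The filtration of the covering poset *)

Section CoverFiltration.
Context {d : Order.disp_t} {X : porderType d} {G : groupType}.
Variables (Xf : int -> set X) (c : coloring X G).
Hypothesis Xf_filtration : is_filtration Xf.
Hypothesis Xf_antichains : induced_by_antichains Xf.

Local Notation V := {freeg (seq (ecover c))}.

Definition cover_bd : {additive V -> V} := bd false.
Definition cover_filt (p n : int) : zmodClosed V :=
  chains false (ecover_on c (Xf p)) n.

Lemma cover_bd_bd v : cover_bd (cover_bd v) = 0.
Proof. exact: bd_bd. Qed.

Lemma cover_filt_le p p' n : p <= p' ->
  {subset cover_filt p n <= cover_filt p' n}.
Proof. by move=> pp'; apply: sub_chains => u; exact: Xf_filtration.1. Qed.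

Definition cover_ss := filtered_ss cover_bd_bd cover_filt_le.

Local Notation fclass := (fclass cover_bd cover_filt).
Local Notation approx_cycles := (approx_cycles cover_bd cover_filt).
Local Notation approx_bounds := (approx_bounds cover_bd cover_filt).

Lemma chains_eq0 (T : porderType d) (A : set T) n z : z \in chains false A n ->
  (n < 0 \/ A = set0) -> z = 0.
Proof.
move=> /chainsP zA nA; apply/eqP; rewrite -dom_eq0; apply/eqP.
case E : (dom z) => [//|s l]; have := zA s; rewrite E mem_head => /(_ isT).
move=> /is_chainP[_ sz sA]; case: s sz sA {E} => [//|x s] /= sz sA _.
case: nA => [|A0]; first by move: sz; lia.
by have := sA x (mem_head _ _); rewrite A0.
Qed.

Lemma cover_filt_neg p n v : p < 0 -> v \in cover_filt p n -> v = 0.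
Proof.
move=> p0 /chains_eq0; apply; right; apply/seteqP; split=> // u.
rewrite /ecover_on /= => Xu; rewrite -[False]/(@set0 X u.1) -Xf_antichains.1.
by apply: Xf_filtration.1 Xu; lia.
Qed.

Lemma cover_filt_deg_neg p n v : n < 0 -> v \in cover_filt p n -> v = 0.
Proof. by move=> n0 /chains_eq0; apply; left. Qed.

Lemma cover_filt_exhaust n v : v \in chains false [set: ecover c] n ->
  exists p, v \in cover_filt p n.
Proof.
move=> vC.
suff [p pP] : exists p, forall u : ecover c, u \in flatten (dom v) -> Xf p u.1.
  exists p; apply/chainsP => s sv.
  have [so sz _ sn] := is_chainP _ _ _ _ (chainsP _ _ _ _ vC s sv).
  apply/is_chainP; split=> // u us; apply: pP.
  by apply/flattenP; exists s.
elim: (flatten _) => [|u l [p pP]]; first by exists 0.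
have [p' _ Xu] : (\bigcup_p Xf p) u.1 by rewrite Xf_filtration.2.
exists (Num.max p p') => w; rewrite inE => /predU1P[->|wl].
  by apply: Xf_filtration.1 Xu; rewrite le_max lexx orbT.
by apply: Xf_filtration.1 (pP w wl); rewrite le_max lexx.
Qed.

Lemma layer_antichain p : 1 <= p -> antichain (layer Xf p).
Proof.
move=> p1; have -> : p = `|p|%N%:Z by lia.
by apply: Xf_antichains.2; lia.
Qed.

(** This is why a chain contains at most one point of a layer. *)
Lemma layer_comparable p x y : 1 <= p -> layer Xf p x -> layer Xf p y ->
  (x >=< y)%O -> x = y.
Proof.
move=> p1 xL yL /orP[]; first exact: (layer_antichain p1).
by move=> yx; apply/esym; exact: (layer_antichain p1).
Qed.

Lemma layerP p (x : layer Xf p) : layer Xf p (val x).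
Proof. exact: set_valP. Qed.

Lemma hatC_prev p x y : 1 <= p -> layer Xf p x -> hatC (Xf p) x y -> Xf (p - 1) y.
Proof.
move=> p1 xL /hatCP[Xy yx yNx]; apply: contrapT => nXy.
by move/eqP: yNx; apply; apply: (layer_comparable p1 _ xL yx).
Qed.

(** * The first page away from the bottom *)

Section Links.
Variables (p q : int).
Hypothesis p1 : 1 <= p.

Local Notation I := (layer_index (G := G) Xf p).
Local Notation link i := (hatC (Xf p) (val i.1)).
Local Notation coeff_at i := (link_coeff c (val i.1) i.2).
Local Notation cone i := (sheet_cone c (val i.1) i.2).
Local Notation deg := (p + q - 1).

Lemma approx_cycles1_chains v : v \in approx_cycles 1 p (p + q) ->
  v \in chains false (ecover_on c (Xf p)) (p + q).
Proof. by case/approx_cyclesP. Qed.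

Lemma link_coeff_prev n (i : I) v : v \in cover_filt (p - 1) n -> coeff_at i v = 0.
Proof. by move=> /link_coeff_sub; apply; case: (layerP i.1). Qed.

(** The boundary of [v] avoids the layer, so its coefficients vanish there. *)
Lemma link_coeff_cycles (i : I) v : v \in approx_cycles 1 p (p + q) ->
  coeff_at i v \in cycles true (link i) deg.
Proof.
move=> vZ; have vC := approx_cycles1_chains vZ; apply/andP; split.
  exact: link_coeff_chains.
rewrite (bd_link_coeff _ _ vC) oppr_eq0; apply/eqP.
by case/approx_cyclesP: vZ => _; exact: link_coeff_prev.
Qed.

Lemma coeff_at_cone (i j : I) n z : z \in chains true (link i) n ->
  coeff_at j (cone i z) = if j == i then z else 0.
Proof.
move=> zC; have [->|ji] := eqVneq j i; first exact: link_coeff_cone zC.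
apply: link_coeff_cone_ne zC; last first.
  apply: contra ji => /eqP[ji1 ji2].
  by rewrite [j]surjective_pairing ji2 (val_inj ji1) -surjective_pairing.
exact: (layer_comparable p1 (layerP _) (layerP _)).
Qed.

Lemma cone_chains (i : I) n z : z \in chains true (link i) n ->
  cone i z \in chains false (ecover_on c (Xf p)) (n + 1).
Proof. by apply: sheet_cone_chains; case: (layerP i.1). Qed.

Lemma coeff_at_cones (r : seq I) n (w : I -> {freeg (seq X)}) (j : I) : uniq r ->
  (forall i, i \in r -> w i \in chains true (link i) n) ->
  coeff_at j (\sum_(i <- r) cone i (w i)) = if j \in r then w j else 0.
Proof.
move=> ru wC; rewrite raddf_sum.
rewrite (eq_big_seq (fun i => if j == i then w i else 0)); last first.
  by move=> i /wC /coeff_at_cone.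
have [jr|jr] := boolP (j \in r); last first.
  by rewrite big1_seq// => i /andP[_ ir]; case: eqP => // ji; rewrite ji ir in jr.
rewrite (bigD1_seq j)//= eqxx big1 ?addr0// => i.
by rewrite eq_sym => /negbTE ->.
Qed.

Lemma coeff_at_finite v : finite_set [set i : I | coeff_at i v != 0].
Proof.
pose emb (i : I) : ecover c := (val i.1, i.2).
have emb_inj : injective emb.
  by move=> [y g] [y' g'] [/val_inj /= -> ->].
apply: (@sub_finite_set _ _ (emb @^-1` [set` flatten (dom v)])).
  by move=> i /= /link_coeff_support[s sv us]; apply/flattenP; exists s.
by apply: finite_preimage; [move=> i i' _ _; exact: emb_inj|exact: finite_seq].
Qed.

Lemma hclass_finite (w : I -> {freeg (seq X)}) :
  finite_set [set i | w i != 0] ->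
  finite_set [set i | (hclass true (link i) deg (w i) : link_homology q i) != 0].
Proof.
apply: sub_finite_set => i /=; apply: contra => /eqP ->.
by rewrite /hclass sqclass0.
Qed.

Lemma finite_setE (J : choiceType) (P : set J) : finite_set P ->
  exists2 r : seq J, uniq r & forall j, (j \in r) <-> P j.
Proof.
move=> /finite_seqP[r ->]; exists (undup r); first exact: undup_uniq.
by move=> j; rewrite mem_undup.
Qed.

(** The residue correspondence. It is stated as a relation, which leaves the
    independence from the representative [v] to [additive_relation_iso]. *)
Definition link_rel (e : fpage cover_bd cover_filt 1 p q)
    (f : first_page (G := G) Xf p q) : Prop :=
  exists v, [/\ v \in approx_cycles 1 p (p + q), e = fclass 1 p q v
    & forall i : I, f i = hclass true (link i) deg (coeff_at i v)].

(** Surjectivity: cone off finitely many cycles of links. Injectivity: when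
    every coefficient of [v] bounds, adding to [v] the boundary of the cones on the
    bounding chains removes all these coefficients, hence brings [v] into the
    previous stage. *)
Lemma link_iso : {f : {additive fpage cover_bd cover_filt 1 p q ->
    first_page (G := G) Xf p q} |
  bijective f /\ forall e w, link_rel e w <-> w = f e}.
Proof.
apply: additive_relation_iso.
- move=> _ _ f f' [v [vZ -> fE]] [v' [vZ' -> fE']]; exists (v - v').
  rewrite rpredB//; split=> //; first by rewrite /fclass sqclassB.
  move=> i; rewrite raddfB /hclass sqclassB; [|exact: link_coeff_cycles..].
  by rewrite -[LHS]/(f i - f' i) fE fE'.
- move=> e; have [v vZ ->] := sqclass_surj e.
  exists (Dsum (hclass_finite (coeff_at_finite v))); exists v; split=> //.
- move=> f.
  have fz (i : I) : {z | z \in cycles true (link i) deg &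
      f i = hclass true (link i) deg z} by exact/cid2/sqclass_surj.
  have [r ru rP] := finite_setE (dsum_fin f).
  pose w i := s2val (fz i).
  have wC i : w i \in cycles true (link i) deg := s2valP (fz i).
  have wC' i : w i \in chains true (link i) deg by case/andP: (wC i).
  have dw i : bd true (w i) = 0 by case/andP: (wC i) => _ /eqP.
  pose v : V := \sum_(i <- r) cone i (w i).
  have vE j : coeff_at j v = if j \in r then w j else 0.
    by apply: (coeff_at_cones _ ru) => i _; exact: wC'.
  have vC : v \in chains false (ecover_on c (Xf p)) (p + q).
    rewrite -[p + q](subrK 1); apply: rpred_sum => i _.
    exact: cone_chains.
  have vZ : v \in approx_cycles 1 p (p + q).
    apply/approx_cyclesP; split=> //.
    apply: (link_coeff_eq0 (chains_bd vC)) => x g Xpx nXpx.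
    have xL : layer Xf p x by [].
    apply/eqP; rewrite -oppr_eq0 -(bd_link_coeff _ _ vC).
    rewrite (vE (SigSub (mem_set xL), g)); case: ifP => _; last exact/eqP/raddf0.
    exact/eqP/dw.
  exists (fclass 1 p q v), v; split=> // i; rewrite vE.
  case: ifP => [_|/negP ir]; first exact: s2valP' (fz i).
  rewrite /hclass sqclass0; apply/eqP; rewrite -[_ == _]negbK; apply/negP.
  by move=> /rP.
- move=> f [v [vZ /esym/eqP + fE]].
  rewrite sqclass_eq0// => /approx_boundsP[a [b [/approx_cyclesP[aF _] bZ vE]]].
  have {bZ} bC : b \in chains false (ecover_on c (Xf p)) (p + q + 1).
    by case/approx_cyclesP: bZ; rewrite addrK.
  apply: dsumP => i; rewrite fE; apply/eqP.
  rewrite /hclass sqclass_eq0 ?link_coeff_cycles// vE raddfD.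
  rewrite (link_coeff_prev _ aF) add0r.
  rewrite -[coeff_at i _]opprK -(bd_link_coeff _ _ bC) rpredN.
  apply/asboolP; exists (coeff_at i b) => //.
  by have := link_coeff_chains (val i.1) i.2 bC; congr (_ \in chains _ _ _); lia.
- move=> _ [v [vZ -> fE]].
  have vC := approx_cycles1_chains vZ.
  have bw (i : I) : {w | w \in chains true (link i) (deg + 1) &
      coeff_at i v = bd true w}.
    apply/cid2; have /esym/eqP := fE i.
    by rewrite /hclass sqclass_eq0 ?link_coeff_cycles// => /asboolP.
  have [r ru rP] := finite_setE (coeff_at_finite v).
  pose w i := s2val (bw i).
  have wC i : w i \in chains true (link i) (deg + 1) := s2valP (bw i).
  have vE i : coeff_at i v = bd true (w i) := s2valP' (bw i).
  pose b : V := \sum_(i <- r) cone i (w i).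
  have bE j : coeff_at j b = if j \in r then w j else 0.
    by apply: (coeff_at_cones _ ru) => i _; exact: wC.
  have bC : b \in chains false (ecover_on c (Xf p)) (p + q + 1).
    rewrite (_ : p + q + 1 = deg + 1 + 1); last lia.
    by apply: rpred_sum => i _; exact: cone_chains.
  have DbC : bd false b \in chains false (ecover_on c (Xf p)) (p + q).
    by have := chains_bd bC; rewrite addrK.
  apply/eqP; rewrite sqclass_eq0//; apply/approx_boundsP.
  have aF : v + bd false b \in cover_filt (p - 1) (p + q).
    apply: (link_coeff_eq0 (rpredD vC DbC)) => x g Xpx nXpx.
    have xL : layer Xf p x by [].
    pose i : I := (SigSub (mem_set xL), g).
    rewrite -[x]/(val i.1) -[g]/(i.2) raddfD.
    rewrite -[X in _ + X]opprK -(bd_link_coeff _ _ bC) bE.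
    case: ifP => [_|/negP ir]; first by rewrite vE subrr.
    rewrite raddf0 subr0; apply/eqP; rewrite -[_ == _]negbK; apply/negP.
    by move=> /rP.
  exists (v + bd false b), (- b); split.
  + apply/approx_cyclesP; split=> //.
    by rewrite subrr subr0; exact: chains_bd aF.
  + rewrite rpredN subrr; apply/approx_cyclesP; rewrite addrK; split=> //.
    by rewrite subr0 addrK.
  + by rewrite raddfN addrK.
Qed.

Lemma cone_approx_cycle (i : I) z : z \in cycles true (link i) deg ->
  cone i z \in approx_cycles 1 p (p + q).
Proof.
move=> /andP[zC /eqP dz].
have vC : cone i z \in chains false (ecover_on c (Xf p)) (p + q).
  by rewrite -[p + q](subrK 1); exact: cone_chains.
apply/approx_cyclesP; split=> //.
apply: (link_coeff_eq0 (chains_bd vC)) => x g Xpx nXpx.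
have xL : layer Xf p x by [].
apply/eqP; rewrite -oppr_eq0 -(bd_link_coeff _ _ vC).
rewrite (coeff_at_cone (SigSub (mem_set xL), g) zC).
by case: ifP => _; [exact/eqP|exact/eqP/raddf0].
Qed.

Lemma link_rel_cone (i : I) z : z \in cycles true (link i) deg ->
  link_rel (fclass 1 p q (cone i z))
    (dsum_inc (link_homology q) i (hclass true (link i) deg z)).
Proof.
move=> zZ; have /andP[zC _] := zZ.
exists (cone i z); split=> //; first exact: cone_approx_cycle.
move=> j; rewrite (coeff_at_cone j zC) /=.
have [->|ij] := eqVneq j i; first by rewrite dfwithin.
by rewrite dfwithout 1?eq_sym// /hclass sqclass0.
Qed.

Lemma link_iso_cone (i : I) z (f : {additive fpage cover_bd cover_filt 1 p q ->
    first_page (G := G) Xf p q}) (e : fpage cover_bd cover_filt 1 p q) :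
  bijective f -> (forall e w, link_rel e w <-> w = f e) ->
  z \in cycles true (link i) deg ->
  f e = dsum_inc (link_homology q) i (hclass true (link i) deg z) ->
  e = fclass 1 p q (cone i z).
Proof.
by move=> fbij fE zC fe; apply: (bij_inj fbij); rewrite fe; apply/fE/link_rel_cone.
Qed.

End Links.

(** * The bottom column *)

(** The stage below 0 being zero, the classes of the column 0 are those of
    cycles over [Xf 0]. *)
Definition base_rel q (e : fpage cover_bd cover_filt 1 0 q)
    (w : homology false (ecover_on c (Xf 0)) q) : Prop :=
  exists v, [/\ v \in cycles false (ecover_on c (Xf 0)) q,
    e = fclass 1 0 q v & w = hclass false (ecover_on c (Xf 0)) q v].

Lemma base_iso q : {f : {additive fpage cover_bd cover_filt 1 0 q ->
    homology false (ecover_on c (Xf 0)) q} |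
  bijective f /\ forall e w, base_rel e w <-> w = f e}.
Proof.
have sub v : v \in cycles false (ecover_on c (Xf 0)) q <->
    v \in approx_cycles 1 0 (0 + q).
  rewrite add0r; split=> [/andP[vC /eqP dv]|/approx_cyclesP[vC dv]].
    by apply/approx_cyclesP; split=> //; rewrite /cover_bd /= dv rpred0.
  apply/andP; split=> //; apply/eqP.
  by apply: cover_filt_neg dv.
apply: additive_relation_iso.
- move=> _ _ _ _ [v [vZ -> ->]] [v' [vZ' -> ->]]; exists (v - v').
  by rewrite rpredB// /fclass /hclass !sqclassB//; exact/sub.
- move=> e; have [v /sub vZ ->] := sqclass_surj e.
  by exists (hclass false (ecover_on c (Xf 0)) q v), v.
- move=> w; have [v vZ ->] := sqclass_surj w.
  by exists (fclass 1 0 q v), v.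
- move=> _ [v [vZ /esym/eqP + ->]].
  rewrite sqclass_eq0; last exact/sub.
  move=> /approx_boundsP[a [b [/approx_cyclesP[aF _] /approx_cyclesP[bF _] ->]]].
  rewrite (cover_filt_neg _ aF)// add0r; apply/eqP; rewrite /hclass sqclass_eq0.
    by apply/asboolP; exists b => //; move: bF; rewrite add0r subrr add0r.
  apply/andP; split; last by apply/eqP; exact: bd_bd.
  have : bd false b \in chains false (ecover_on c (Xf 0)) (q + 1 - 1).
    by apply: chains_bd; move: bF; rewrite add0r subrr add0r.
  by rewrite addrK.
- move=> _ [v [vZ -> /esym/eqP]]; rewrite /hclass sqclass_eq0//.
  move=> /asboolP[b bC vE]; apply/eqP; rewrite sqclass_eq0; last exact/sub.
  apply/approx_boundsP; exists 0, b; rewrite rpred0; split=> //; last by rewrite add0r.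
  rewrite !add0r subrr; apply/approx_cyclesP; rewrite subr0 addrK; split=> //.
  by rewrite -[cover_bd b]vE; case/andP: vZ.
Qed.

(** The key to the first differential: the class at [(x, g)] of a cycle [z] is
    represented by the cone on the lift of [z], whose boundary is that lift. *)
Lemma to_sheet_cycles p q (x : layer Xf p) g z : 1 <= p -> 0 <= p + q - 1 ->
  z \in cycles true (hatC (Xf p) (val x)) (p + q - 1) ->
  to_sheet c g (val x) z \in cycles false (ecover_on c (Xf (p - 1))) (p + q - 1)
  /\ cover_bd (sheet_cone c (val x) g z) = to_sheet c g (val x) z.
Proof.
move=> p1 n0 /andP[zC /eqP dz]; have bE := bd_sheet_cone c g n0 zC dz.
split=> //; apply/andP; split; last by rewrite -bE bd_bd.
have zC' : z \in chains true (hatC (Xf (p - 1)) (val x)) (p + q - 1).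
  apply/chainsP => s sz.
  have [so ss sA sn] := is_chainP _ _ _ _ (chainsP _ _ _ _ zC s sz).
  apply/is_chainP; split=> // y ys; have [Xy yx yNx] := (hatCP _ _ _).1 (sA y ys).
  by apply/hatCP; split=> //; apply: (hatC_prev p1 (layerP x)); exact: sA.
have /chainsP tC := chains_to_sheet c g zC'.
apply/chainsP => s /tC /is_chainP[so ss sA sn]; apply/is_chainP; split=> //.
  by move=> u /sA /hatCP[].
by case: s ss {so sA sn} => //=; lia.
Qed.

Lemma fclass_neg p q (e : fpage cover_bd cover_filt 1 p q) : p < 0 -> e = 0.
Proof.
move=> p0; have [v /approx_cyclesP[vF _] ->] := sqclass_surj e.
by rewrite (cover_filt_neg p0 vF) sqclass0.
Qed.

Lemma fclass_deg_neg p q (e : fpage cover_bd cover_filt 1 p q) : p + q < 0 -> e = 0.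
Proof.
move=> p0; have [v /approx_cyclesP[vF _] ->] := sqclass_surj e.
by rewrite (cover_filt_deg_neg p0 vF) sqclass0.
Qed.

(** * Finiteness of the filtration on homology *)

(** If the reduced homology of the links vanishes in degree [n - 1], the column
    [p] of the first page vanishes in total degree [n], so that cycles can be moved
    down one stage. *)
Lemma cover_filt_stationary n p v : 1 <= p ->
  (forall x, layer Xf p x ->
     forall h : homology true (hatC (Xf p) x) (n - 1), h = 0) ->
  v \in cover_filt p n -> cover_bd v = 0 ->
  exists z, [/\ z \in cover_filt (p - 1) n, cover_bd z = 0 &
    v - z \in boundaries false [set: ecover c] n].
Proof.
move=> p1 lk vF dv; pose q := n - p.
have nE : p + q = n by rewrite /q; lia.
have [f [fbij fE]] := link_iso q p1.
have vZ : v \in approx_cycles 1 p (p + q).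
  by apply/approx_cyclesP; rewrite dv rpred0 nE.
have /eqP : fclass 1 p q v = 0.
  apply: (bij_inj fbij); rewrite raddf0; apply: dsumP => i.
  have lkE k : k = n - 1 ->
      forall h : homology true (hatC (Xf p) (val i.1)) k, h = 0.
    by move=> ->; apply: lk; exact: layerP.
  by apply: (lkE (p + q - 1)); rewrite nE.
rewrite sqclass_eq0// nE.
move=> /approx_boundsP[a [b [/approx_cyclesP[aF _] /approx_cyclesP[bF _] vE]]].
have aE : a = v - cover_bd b by rewrite vE addrK.
exists a; split=> //; first by rewrite aE raddfB dv cover_bd_bd subr0.
rewrite aE opprB addrC subrK; apply/asboolP; exists b => //.
by apply: sub_chains bF => u.
Qed.

(** In degree at least 2 the links eventually have no homology. Their vanishing
    is not assumed in degree 0, nor in degree -1, so the degrees 0 and 1 rest on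
    simple connectedness: all points are homologous and 1-cycles bound. *)
Lemma cover_bounded (R : realType) (x0 : X) :
  simply_connected R (alexandroff (ecover c)) ->
  (forall n : nat, (0 < n)%N -> exists2 m : nat, (0 < m)%N &
     forall p : int, m%:Z <= p -> forall x, layer Xf p x ->
     forall h : homology true (hatC (Xf p) x) n%:Z, h = 0) ->
  forall n, exists p, forall v, v \in cycles false [set: ecover c] n ->
    exists z, [/\ z \in cover_filt p n, cover_bd z = 0 &
      v - z \in boundaries false [set: ecover c] n].
Proof.
move=> E_sc lk.
case=> [[|[|n]]|n].
- have [p _ Xp] : (\bigcup_p Xf p) x0 by rewrite Xf_filtration.2.
  exists p => v /andP[vC _].
  have [k kB] := cycles0_point E_sc ((x0, 1%g) : ecover c) vC.
  exists << k *g [:: ((x0, 1%g) : ecover c)] >>; split=> //.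
    rewrite -freegUZ; apply/zmodClosedZ/chainsU/is_chainP; split=> // u.
    by rewrite inE => /eqP ->.
  apply: bdf_small => s; rewrite -freegUZ => /domZ_subset.
  by rewrite domU1 inE => /eqP ->.
- exists 0 => v vZ; exists 0; rewrite rpred0 raddf0 subr0; split=> //.
  exact: (cycles1_boundary E_sc).
- have [m m0 mP] := lk n.+1 isT; exists m%:Z => v /andP[vC /eqP dv].
  have [p vF] := cover_filt_exhaust vC.
  have {}vF : v \in cover_filt (m%:Z + `|p|%N%:Z) n.+2%:Z.
    by apply: cover_filt_le vF; lia.
  move: `|p|%N vF => k; elim: k v {vC p} dv => [|k IH] v dv.
    rewrite addr0 => vF; exists v; split=> //; rewrite subrr.
    exact: rpred0.
  move=> vF; have [||z [zF dz zB]] := cover_filt_stationary _ _ vF dv.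
  + lia.
  + have -> : n.+2%:Z - 1 = n.+1%:Z by lia.
    by apply: mP; lia.
  have [|z' [z'F dz' z'B]] := IH z dz.
    by move: zF; congr (_ \in cover_filt _ _); lia.
  exists z'; split=> //; have -> : v - z' = (v - z) + (z - z') by rewrite addrA subrK.
  exact: rpredD.
- exists 0 => v /andP[vC _]; exists 0; rewrite rpred0 raddf0 subr0; split=> //.
  by rewrite (chains_eq0 vC) ?rpred0//; left.
Qed.

(** * The first differential *)

Lemma rem_map (T T' : eqType) (f : T -> T') (y : T) s : injective f ->
  rem (f y) (map f s) = map f (rem y s).
Proof.
move=> f_inj; elim: s => //= x s IH.
by rewrite (inj_eq f_inj); case: eqP => //= _; rewrite IH.
Qed.

(** Exactly one point over [y] lies on the sheet of [(x, g)]. *)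
Lemma link_coeff_to_sheet x g y h s :
  link_coeff c y h (to_sheet c g x << s >>) =
  if (y \in s) && (h == g * colx c x y)%g then sgn s y *: << rem y s >> else 0.
Proof.
rewrite to_sheetU /link_coeff /=.
pose F (y : X) : ecover c := (y, (g * colx c x y)%g).
have F_inj : injective F by move=> y1 y2 [].
rewrite -[ecover_lift c g x s]/(map F s).
have -> : (y \in s) && (h == g * colx c x y)%g = (((y, h) : ecover c) \in map F s).
  apply/andP/mapP => [[ys /eqP ->]|[y' y's [-> ->]]]; first by exists y.
  by rewrite y's.
rewrite fgextU; case: ifP => [/mapP[y' y's [yE hE]]|_]; last exact: raddf0.
rewrite additiveZ fgextU yE hE -[(y', _)]/(F y') rem_map//.
by rewrite -map_comp map_id_in// /sgn (index_map F_inj).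
Qed.

Lemma link_coeff_to_sheet_sum x g y h l (a : 'I_l -> int) (s : 'I_l -> seq X) :
  link_coeff c y h (to_sheet c g x (\sum_(i < l) a i *: << s i >>)) =
  if h == (g * colx c x y)%g
  then \sum_(i < l | y \in s i) (a i * sgn (s i) y) *: << rem y (s i) >> else 0.
Proof.
rewrite !raddf_sum (eq_bigr (fun i => if h == (g * colx c x y)%g then
   (if y \in s i then (a i * sgn (s i) y) *: << rem y (s i) >> else 0) else 0)).
  by case: eqP => _; [rewrite -big_mkcond|rewrite big1].
move=> i _; rewrite !additiveZ link_coeff_to_sheet.
by case: (y \in s i); case: eqP => _ /=; rewrite ?scaler0// scalerA.
Qed.

Section Differential.
Variables (p q : int) (x : layer Xf p) (g : G) (l : nat).
Variables (a : 'I_l -> int) (s : 'I_l -> seq X).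
Hypothesis p1 : 1 <= p.
Hypothesis n0 : 0 <= p + q - 1.
Hypothesis s_chain :
  forall i, is_chain true (hatC (Xf p) (val x)) (p + q - 1) (s i).

Let z := \sum_(i < l) a i *: << s i >>.
Hypothesis dz : bd true z = 0.

Lemma sum_cycle : z \in cycles true (hatC (Xf p) (val x)) (p + q - 1).
Proof.
apply/andP; split; last exact/eqP.
by apply: rpred_sum => i _; exact/zmodClosedZ/chainsU.
Qed.

Lemma link_rel_to_sheet : 2 <= p ->
  @link_rel (p - 1) q (fclass 1 (p - 1) q (to_sheet c g (val x) z))
   (\sum_(y \in [set y : layer Xf (p - 1) | Cset [set: X] (val x) (val y)])
      inc q y (g * colx c (val x) (val y))%g
        (\sum_(i < l | val y \in s i)
           (a i * sgn (s i) (val y)) *: << rem (val y) (s i) >>)).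
Proof.
move=> p2; have [/andP[tC /eqP dt] _] := to_sheet_cycles g p1 n0 sum_cycle.
have degE : p - 1 + q = p + q - 1 by lia.
exists (to_sheet c g (val x) z); split=> //.
  by apply/approx_cyclesP; rewrite /cover_bd /= dt rpred0 degE.
move=> [y h]; rewrite -[(y, h).1]/y -[(y, h).2]/h /z link_coeff_to_sheet_sum.
set w := fun y : layer Xf (p - 1) => \sum_(i < l | val y \in s i)
   (a i * sgn (s i) (val y)) *: << rem (val y) (s i) >>.
set B := [set y : layer Xf (p - 1) | _].
pose P := [set y : layer Xf (p - 1) | exists i, val y \in s i].
have PB : P `<=` B.
  move=> y' [i y's]; have [_ _ sA _] := is_chainP _ _ _ _ (s_chain i).
  by have [_ yx _] := (hatCP _ _ _).1 (sA _ y's).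
have finP : finite_set P.
  apply: (@sub_finite_set _ _ (val @^-1` [set` flatten [seq s i | i <- enum 'I_l]])).
    move=> y' [i y's] /=; apply/flattenP; exists (s i) => //.
    by apply/mapP; exists i; rewrite ?mem_enum.
  by apply: finite_preimage; [move=> ? ? _ _; exact: val_inj|exact: finite_seq].
have [r ru rP] := finite_setE finP.
have w0 y' : y' \notin r -> w y' = 0.
  move=> /negP y'r; rewrite /w big1// => i y's; exfalso; apply/y'r/rP.
  by exists i.
have inc0 y' k : inc q y' k 0 = 0 :> first_page Xf (p - 1) q.
  apply: dsumP => j; rewrite /inc /= /hclass sqclass0.
  by case: dfwithP.
rewrite (fsbigE r)//; first last.
- by move=> y' _ /w0; rewrite -/(w y') => ->; exact: inc0.
- by move=> y' /= /rP /PB.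
pose ev (f : first_page (G := G) Xf (p - 1) q) := f (y, h).
have evD : {morph ev : f f' / f + f' >-> f + f'} by [].
rewrite -[LHS]/(ev _) (big_morph ev evD (erefl : ev 0 = 0)).
have evF y' : ev (inc q y' (g * colx c (val x) (val y'))%g (w y')) =
    if (y' == y) && (h == (g * colx c (val x) (val y))%g)
    then hclass true (hatC (Xf (p - 1)) (val y)) (p - 1 + q - 1) (w y) else 0.
  rewrite /ev /inc /=; case: andP => [[/eqP -> /eqP ->]|yh].
    by rewrite dfwithin.
  rewrite dfwithout//; apply/eqP => -[yE hE]; apply: yh.
  by rewrite -yE hE !eqxx.
under eq_bigr do rewrite evF.
have [hE|_] := eqVneq h; last first.
  rewrite big1 ?/hclass ?sqclass0// => y' _.
  by rewrite andbF.
under eq_bigr do rewrite andbT.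
rewrite -/(w y); have [yr|yr] := boolP (y \in r); last first.
  rewrite w0// /hclass sqclass0 big1// => y' _.
  by case: (y' == y).
have yB : y \in B by apply/mem_set/PB/rP.
rewrite big_mkcond (bigD1_seq y)//= yB eqxx big1 ?addr0// => y' /negbTE ->.
by case: ifP.
Qed.

End Differential.

End CoverFiltration.

Theorem theorem5p5 (R : realType) (d : Order.disp_t) (X : porderType d)
    (Xf : int -> set X) (x0 : X) (G : groupType) (c : coloring X G)
  (X_connected : connected [set: alexandroff X])
  (X_locally_finite : locally_finite X)
  (Xf_filtration : is_filtration Xf)
  (Xf_antichains : induced_by_antichains Xf)
  (links_vanish : forall n : nat, (0 < n)%N -> exists2 m : nat, (0 < m)%N &
     forall p : int, m%:Z <= p -> forall x, layer Xf p x ->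
     forall h : homology true (hatC (Xf p) x) n%:Z, h = 0)
  (G_pi1 : is_pi1 R (x0 : alexandroff X) G)
  (c_connected : connected_coloring c)
  (c_universal : universal_cover R (ecover_proj c)) :
  exists S : spectral_sequence,
    converges S (fun n => homology false [set: ecover c] n) /\
    exists (psi : forall q : int,
              {additive page S 1 0 q -> homology false (ecover_on c (Xf 0)) q})
           (phi : forall p q : int,
              {additive page S 1 p q -> first_page (G := G) Xf p q}),
    [/\ forall p q : int, p <= -1 -> forall e : page S 1 p q, e = 0,
        forall q : int, bijective (psi q),
        forall p q : int, 1 <= p -> bijective (phi p q)
      & [/\ forall p q : int, p <= 0 ->
              forall e : page S 1 p q, ss_d S 1 p q (p - 1) q e = 0,
            forall q : int, 0 <= q ->
              forall (x : layer Xf 1) (g : G)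
                (l : nat) (a : 'I_l -> int) (s : 'I_l -> seq X),
              (forall i, is_chain true (hatC (Xf 1) (val x)) q (s i)) ->
              bd true (\sum_(i < l) a i *: << s i >>) = 0 ->
              forall e : page S 1 1 q,
              phi 1 q e = inc q x g (\sum_(i < l) a i *: << s i >>) ->
              psi q (ss_d S 1 1 q 0 q e) =
              hclass false (ecover_on c (Xf 0)) q
                (\sum_(i < l) a i *: << ecover_lift c g (val x) (s i) >>),
            forall p q : int, 1 <= p -> q <= - p ->
              forall e : page S 1 p q, ss_d S 1 p q (p - 1) q e = 0
          & forall p q : int, 2 <= p -> 1 - p <= q ->
              forall (x : layer Xf p) (g : G)
                (l : nat) (a : 'I_l -> int) (s : 'I_l -> seq X),
              (forall i,
                 is_chain true (hatC (Xf p) (val x)) (p + q - 1) (s i)) ->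
              bd true (\sum_(i < l) a i *: << s i >>) = 0 ->
              forall e : page S 1 p q,
              phi p q e = inc q x g (\sum_(i < l) a i *: << s i >>) ->
              phi (p - 1) q (ss_d S 1 p q (p - 1) q e) =
              \sum_(y \in [set y : layer Xf (p - 1) |
                             Cset [set: X] (val x) (val y)])
                inc q y (g * colx c (val x) (val y))%g
                  (\sum_(i < l | val y \in s i)
                     (a i * sgn (s i) (val y)) *: << rem (val y) (s i) >>)]].
Proof.
pose S := cover_ss c Xf_filtration; exists S; split.
  refine (@filtered_ss_converges _ _ _ (cover_bd_bd (c := c))
    (cover_filt_le (c := c) Xf_filtration) _
    (fun n => cycles false [set: ecover c] n)
    (fun n => boundaries false [set: ecover c] n) _ _ _).
  - exact: (cover_filt_neg Xf_filtration Xf_antichains).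
  - move=> n v; split=> [/andP[vC /eqP dv]|[p vF dv]].
      by have [p vF] := cover_filt_exhaust Xf_filtration vC; exists p.
    apply/andP; split; last exact/eqP.
    by apply: sub_chains vF => u.
  - move=> n v; split=> [/asboolP[w wC ->]|[p [w [wF ->]]]].
      by have [p wF] := cover_filt_exhaust Xf_filtration wC; exists p, w.
    by apply/asboolP; exists w => //; apply: sub_chains wF => u.
  - exact: (cover_bounded Xf_filtration Xf_antichains x0 c_universal.2 links_vanish).
pose psi q := sval (base_iso c Xf_filtration Xf_antichains q).
have phiP p q : {f : {additive page S 1 p q -> first_page (G := G) Xf p q} |
    1 <= p -> bijective f /\ forall e w, link_rel e w <-> w = f e}.
  have [p1|p1] := pselect (1 <= p); last first.
    by exists (additive_of (@zero_additive _ _)).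
  by have [f fP] := link_iso c Xf_antichains q p1; exists f.
exists psi, (fun p q => sval (phiP p q)).
have psiP q := svalP (base_iso c Xf_filtration Xf_antichains q).
have phiP' p q (p1 : 1 <= p) := svalP (phiP p q) p1.
have neg0 p q (e : page S 1 p q) : p < 0 -> e = 0.
  exact: fclass_neg.
split.
- by move=> p q p0 e; apply: neg0; lia.
- by move=> q; case: (psiP q).
- by move=> p q /(phiP' p q)[].
split.
- by move=> p q p0 e; apply: neg0; lia.
- move=> q q0 x g l a s sC dz e; set z := \sum_(i < l) _ => phie.
  have p1 : 1 <= 1 :> int by [].
  have degE : 1 + q - 1 = q by rewrite addrAC subrr add0r.
  have sC' i : is_chain true (hatC (Xf 1) (val x)) (1 + q - 1) (s i).
    by rewrite degE.
  have zC := sum_cycle sC' dz.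
  have [fbij fE] := phiP' 1 q p1.
  have eE := link_iso_cone Xf_antichains (i := (x, g)) p1 fbij fE zC phie.
  have n0 : 0 <= 1 + q - 1 by rewrite degE.
  have [tC bE] := to_sheet_cycles c Xf_antichains g p1 n0 zC.
  rewrite degE in tC.
  apply/esym/(psiP q).2; exists (to_sheet c g (val x) z); split=> //.
    rewrite eE -bE; apply: fdiffE; [by []|lia|].
    exact: (@cone_approx_cycle _ _ _ _ c Xf_antichains _ _ p1 (x, g) z zC).
  rewrite /z raddf_sum; congr hclass; apply: eq_bigr => i _.
  by rewrite additiveZ to_sheetU.
- by move=> p q p1 qp e; apply: fclass_deg_neg; lia.
- move=> p q p2 pq x g l a s sC dz e; set z := \sum_(i < l) _ => phie.
  have p1 : 1 <= p by lia.
  have n0 : 0 <= p + q - 1 by lia.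
  have zC := sum_cycle sC dz.
  have [fbij fE] := phiP' p q p1.
  have eE := link_iso_cone Xf_antichains (i := (x, g)) p1 fbij fE zC phie.
  have [_ bE] := to_sheet_cycles c Xf_antichains g p1 n0 zC.
  have p1' : 1 <= p - 1 by lia.
  have [_ fE'] := phiP' (p - 1) q p1'.
  apply/esym/fE'; rewrite eE (_ : ss_d S _ _ _ _ _ _ =
    fclass (cover_bd c) (cover_filt Xf c) 1 (p - 1) q (to_sheet c g (val x) z)).
    exact: link_rel_to_sheet.
  rewrite -bE; apply: fdiffE; [by []|lia|].
  exact: (@cone_approx_cycle _ _ _ _ c Xf_antichains _ _ p1 (x, g) z zC).
Qed.
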